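(* Let $\mathbb{K}$ be a field, let $m\ge1$, and let $G$ be a two-ear graph of type $m$, labeled as $\mathbf{G}_m$. Let $<$ be a monomial order on $\mathbb{K}[E(G)]$ for which the minimal set of monomial generators of $\mathrm{in}_<(I_G)$ is $\mathcal{M}=\mathcal{M}_1\sqcup\mathcal{M}_2\sqcup\mathcal{M}_3\sqcup\mathcal{M}_4$. Then for any $0\le i\le m$, $$\beta_i(\mathbb{K}[G])=\beta_i\bigl(\mathbb{K}[E(G)]/\mathrm{in}_<(I_G)\bigr).$$
   Context: For a simple graph $G$ with vertex set $V(G)$ and edge set $E(G)$, the edge ring $\mathbb{K}[G]$ is the subalgebra of $\mathbb{K}[x: x\in V(G)]$ generated by the monomials $x_e=xy$ for $e=\{x,y\}\in E(G)$. $\mathbb{K}[E(G)]$ is the polynomial ring with one variable for each edge; the toric ideal $I_G$ is the kernel of $\mathbb{K}[E(G)]\to\mathbb{K}[G]$, $e\mapsto x_e$. $\beta_i(M)=\dim_{\mathbb{K}}\mathrm{Tor}_i^{\mathbb{K}[E(G)]}(M,\mathbb{K})$ is the $i$-th total Betti number. For $m\ge1$, $\mathbf{G}_m$ is the simple graph with vertices $v_1,v_2,x_1,x_2,y_1,y_2,u_1,\ldots,u_{m-1}$ and edges labeled $e_{i,1}=\{v_1,u_i\}$, $e_{i,2}=\{v_2,u_i\}$ ($1\le i\le m-1$), $f_1=\{v_1,x_1\}$, $f_2=\{x_1,x_2\}$, $f_3=\{v_1,x_2\}$, $g_1=\{v_2,y_1\}$, $g_2=\{y_1,y_2\}$, $g_3=\{v_2,y_2\}$,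 $w=\{x_1,y_1\}$. A two-ear graph of type $m$ is a graph isomorphic to $\mathbf{G}_m$. The sets of monomials in $\mathbb{K}[E(G)]$ are: $\mathcal{M}_1=\{e_{i,1}e_{j,2}\mid1\le i<j\le m-1\}$, $\mathcal{M}_2=\{f_1f_2g_1g_2\}$, $\mathcal{M}_3=\{g_1f_2e_{i,1}\mid1\le i\le m-1\}$, $\mathcal{M}_4=\{g_2f_1e_{i,2}\mid1\le i\le m-1\}$. A monomial order with the required initial ideal exists (known from the literature). *)

(* Defs.v *)
From HB Require Import structures.
From mathcomp Require Import all_boot all_order all_algebra.
From mathcomp Require Import ring_quotient boolp.
From mathcomp Require Import mpoly.

Set Implicit Arguments.
Unset Strict Implicit.
Unset Printing Implicit Defensive.

Import GRing.Theory.
Local Open Scope ring_scope.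
Local Open Scope quotient_scope.

Section Ideal.
Variable S : comNzRingType.

(* Finite S-linear combinations of elements of P. *)
Inductive ideal_gen (P : S -> Prop) : S -> Prop :=
| ideal_gen0 : ideal_gen P 0
| ideal_genMD a g p : P g -> ideal_gen P p -> ideal_gen P (a * g + p).

Definition ideal (P : S -> Prop) : {pred S} := fun p => `[< ideal_gen P p >].

Lemma ideal_genD P p q : ideal_gen P p -> ideal_gen P q -> ideal_gen P (p + q).
Proof.
elim=> [|a g r Pg _ IH] Iq; first by rewrite add0r.
by rewrite -addrA; apply: ideal_genMD => //; apply: IH.
Qed.

Lemma ideal_genM P a p : ideal_gen P p -> ideal_gen P (a * p).
Proof.
elim=> [|b g r Pg _ IH]; first by rewrite mulr0; exact: ideal_gen0.
by rewrite mulrDr mulrA; apply: ideal_genMD.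
Qed.

Lemma ideal_zmod_closed P : zmod_closed (ideal P).
Proof.
split=> [|p q /asboolP Ip /asboolP Iq]; apply/asboolP; first exact: ideal_gen0.
by apply: ideal_genD => //; rewrite -mulN1r; apply: ideal_genM.
Qed.

HB.instance Definition _ P := GRing.isZmodClosed.Build S (ideal P)
  (ideal_zmod_closed P).

Lemma idealMl P a p : p \in ideal P -> a * p \in ideal P.
Proof. by move=> /asboolP Ip; apply/asboolP; apply: ideal_genM. Qed.

(* The S-module S / I for the ideal I generated by P; ring_quotient's
   {ideal_quot I} would require 1 \notin I. *)
Definition quot_mod (P : S -> Prop) : Type := @Quotient.quot S (ideal P).

HB.instance Definition _ P := GRing.Zmodule.on (quot_mod P).

Section QuotMod.
Variable P : S -> Prop.

Definition quot_proj (p : S) : quot_mod P := \pi_(@Quotient.quot S (ideal P)) p.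
Definition quot_scale (a : S) (x : quot_mod P) : quot_mod P :=
  quot_proj (a * repr (x : @Quotient.quot S (ideal P))).

Lemma quot_projE p q : (quot_proj p = quot_proj q) <-> (p - q \in ideal P).
Proof.
by rewrite Quotient.idealrBE; split=> [|pq]; [move/eqP | exact/eqP].
Qed.

Lemma quot_projK (x : quot_mod P) : quot_proj (repr (x : @Quotient.quot S (ideal P))) = x.
Proof. exact: reprK. Qed.

Lemma quot_projD p q : quot_proj (p + q) = quot_proj p + quot_proj q.
Proof. exact: (raddfD (\pi_(@Quotient.quot S (ideal P)))). Qed.

Lemma quot_scaleE a p : quot_scale a (quot_proj p) = quot_proj (a * p).
Proof.
by apply/quot_projE; rewrite -mulrBr; apply/idealMl/quot_projE/quot_projK.
Qed.

Lemma quot_scaleA a b x : quot_scale a (quot_scale b x) = quot_scale (a * b) x.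
Proof. by rewrite -[x]quot_projK !quot_scaleE mulrA. Qed.

Lemma quot_scale1 : left_id 1 quot_scale.
Proof. by move=> x; rewrite -[x]quot_projK quot_scaleE mul1r. Qed.

Lemma quot_scaleDr : right_distributive quot_scale +%R.
Proof.
move=> a x y; rewrite -[x]quot_projK -[y]quot_projK -quot_projD !quot_scaleE.
by rewrite mulrDr quot_projD.
Qed.

Lemma quot_scaleDl x : {morph quot_scale^~ x : a b / a + b}.
Proof.
by move=> a b; rewrite -[x]quot_projK !quot_scaleE mulrDl quot_projD.
Qed.

HB.instance Definition _ := GRing.Zmodule_isLmodule.Build S (quot_mod P)
  quot_scaleA quot_scale1 quot_scaleDr quot_scaleDl.

End QuotMod.
End Ideal.

(* Vectors are rows, so the differential F_(i+1) -> F_i is v |-> v *m res_d i. *)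
Record free_resolution (S : comNzRingType) (M : lmodType S) := FreeResolution {
  res_rk : nat -> nat;
  res_d : forall i, 'M[S]_(res_rk i.+1, res_rk i);
  res_aug : {linear 'rV[S]_(res_rk 0) -> M};
  res_aug_surj : forall x, exists v, res_aug v = x;
  res_exact0 : forall v, res_aug v = 0 <-> exists w, v = w *m res_d 0;
  res_exactS : forall i (v : 'rV_(res_rk i.+1)),
    v *m res_d i = 0 <-> exists w, v = w *m res_d i.+1
}.

Section Betti.
Variables (K : fieldType) (n : nat) (M : lmodType {mpoly K[n]}).

(* F (x)_S K, where K = S / (variables): the entries of the differentials are
   replaced by their constant coefficients. *)
Definition res_dK (F : free_resolution M) (i : nat) :
    'M[K]_(res_rk F i.+1, res_rk F i) :=
  map_mx (mcoeff 0%MM) (res_d F i).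

(* dim of H_i(F (x)_S K): dimension of the cycles minus that of the boundaries
   (a subspace of the cycles, as the differentials of F compose to 0). *)
Definition tor_dim (F : free_resolution M) (i : nat) : nat :=
  match i with
  | 0 => res_rk F 0 - \rank (res_dK F 0)
  | j.+1 => \rank (kermx (res_dK F j)) - \rank (res_dK F j.+1)
  end%N.

(* dim_K Tor_i(M, K), computed from some resolution of M by finite free modules;
   such a resolution exists for every finitely generated M, since {mpoly K[n]}
   is Noetherian.  The value 0 is junk, for the other modules. *)
Definition betti (i : nat) : nat :=
  match pselectT (free_resolution M) with
  | inr F => tor_dim F i
  | inl _ => 0%N
  end.

End Betti.

Record monomial_order n (le : rel 'X_{1..n}) : Prop := MonomialOrder {
  mo_anti : antisymmetric le;
  mo_trans : transitive le;
  mo_total : total le;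
  mo_ge0 : forall a, le 0%MM a;
  mo_add : forall a b c, le a b -> le (a + c)%MM (b + c)%MM
}.

Section InitialIdeal.
Variables (K : fieldType) (n : nat).
Implicit Types (I : {pred {mpoly K[n]}}) (le : rel 'X_{1..n}).

Definition is_leading_mon le (p : {mpoly K[n]}) (a : 'X_{1..n}) : Prop :=
  a \in msupp p /\ forall b, b \in msupp p -> le b a.

Definition leading_mons le I (q : {mpoly K[n]}) : Prop :=
  exists p a, [/\ p \in I, is_leading_mon le p a & q = 'X_[a]].

(* quot_mod (leading_mons le I) is the quotient by this ideal. *)
Definition initial_ideal le I : {pred {mpoly K[n]}} := ideal (leading_mons le I).

Definition mons (A : 'X_{1..n} -> Prop) (q : {mpoly K[n]}) : Prop :=
  exists2 a, A a & q = 'X_[a].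

Definition minimal_mon_gens I (A : 'X_{1..n} -> Prop) : Prop :=
  I =i ideal (mons A) /\
  forall B : 'X_{1..n} -> Prop, (forall a, B a -> A a) ->
    I =i ideal (mons B) -> forall a, A a -> B a.

End InitialIdeal.

Record sgraph := SGraph {
  vertex :> finType;
  adj : rel vertex;
  adj_sym : ssrbool.symmetric adj;
  adj_irr : irreflexive adj
}.

Definition edge_set (G : sgraph) : {set {set G}} :=
  [set e | [exists x, exists y, adj x y && (e == [set x; y])]].

Definition edge (G : sgraph) : finType := {e : {set G} | e \in edge_set G}.

Section GenSubalg.
Variables (K : fieldType) (A : comAlgType K).

Inductive subalg_gen (P : A -> Prop) : A -> Prop :=
| subalg_gen_in p : P p -> subalg_gen P p
| subalg_genC c : subalg_gen P c%:A
| subalg_genD p q : subalg_gen P p -> subalg_gen P q -> subalg_gen P (p + q)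
| subalg_genM p q : subalg_gen P p -> subalg_gen P q -> subalg_gen P (p * q).

Definition subalg (P : A -> Prop) : {pred A} := fun p => `[< subalg_gen P p >].

Lemma subalg_subring_closed P : subring_closed (subalg P).
Proof.
split=> [|p q /asboolP Sp /asboolP Sq|p q /asboolP Sp /asboolP Sq];
  apply/asboolP; last exact: subalg_genM.
- by rewrite -[1]scale1r; exact: subalg_genC.
- apply: subalg_genD => //; rewrite -[q]mul1r -mulNr -scaleN1r.
  by apply: subalg_genM => //; exact: subalg_genC.
Qed.

HB.instance Definition _ P := GRing.isSubringClosed.Build A (subalg P)
  (subalg_subring_closed P).

End GenSubalg.

Section EdgeRing.
Variables (K : fieldType) (G : sgraph).

Local Notation S := {mpoly K[#|edge G|]}.
Local Notation R := {mpoly K[#|G|]}.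

Definition edge_mon (e : edge G) : R := \prod_(x in val e) 'X_(enum_rank x).

Definition edge_subalg : {pred R} := subalg (fun p => exists e, p = edge_mon e).

Definition edge_ring : Type := {p : R | p \in edge_subalg}.

HB.instance Definition _ := SubChoice.on edge_ring.
HB.instance Definition _ := [SubChoice_isSubComNzRing of edge_ring by <:].

Definition toric_map : S -> R :=
  comp_mpoly [tuple edge_mon (enum_val i) | i < #|edge G|].

Definition toric_ideal : {pred S} := fun q => toric_map q == 0.

Lemma toric_map_in q : toric_map q \in edge_subalg.
Proof.
rewrite /toric_map /comp_mpoly /mmap rpred_sum // => a _; apply: rpredM.
  by apply/asboolP; rewrite -[X in subalg_gen _ X]alg_mpolyC; exact: subalg_genC.
apply: rpred_prod => i _; apply: rpredX; rewrite tnth_mktuple.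
by apply/asboolP/subalg_gen_in; exists (enum_val i).
Qed.

(* K[G] is a K[E(G)]-module through toric_map. *)
Definition edge_ring_map (q : S) : edge_ring := Sub (toric_map q) (toric_map_in q).

Definition edge_ring_scale (q : S) (x : edge_ring) : edge_ring :=
  edge_ring_map q * x.

Lemma edge_ring_scaleA a b x :
  edge_ring_scale a (edge_ring_scale b x) = edge_ring_scale (a * b) x.
Proof. by apply: val_inj; rewrite /= /toric_map rmorphM mulrA. Qed.

Lemma edge_ring_scale1 : left_id 1 edge_ring_scale.
Proof. by move=> x; apply: val_inj; rewrite /= /toric_map rmorph1 mul1r. Qed.

Lemma edge_ring_scaleDr : right_distributive edge_ring_scale +%R.
Proof. by move=> a x y; rewrite /edge_ring_scale mulrDr. Qed.

Lemma edge_ring_scaleDl x : {morph edge_ring_scale^~ x : a b / a + b}.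
Proof. by move=> a b; apply: val_inj; rewrite /= /toric_map rmorphD mulrDl. Qed.

HB.instance Definition _ := GRing.Zmodule_isLmodule.Build S edge_ring
  edge_ring_scaleA edge_ring_scale1 edge_ring_scaleDr edge_ring_scaleDl.

End EdgeRing.
Arguments toric_ideal : clear implicits.

(* The ordinal i : 'I_m.-1 stands for the index i + 1 in 1, ..., m - 1. *)
Inductive te_vertex (m : nat) : Type :=
| v1 | v2 | x1 | x2 | y1 | y2 | u of 'I_m.-1.

Inductive te_label (m : nat) : Type :=
| e1 of 'I_m.-1 | e2 of 'I_m.-1 | f1 | f2 | f3 | g1 | g2 | g3 | w.

Arguments v1 {m}. Arguments v2 {m}. Arguments x1 {m}. Arguments x2 {m}.
Arguments y1 {m}. Arguments y2 {m}.
Arguments f1 {m}. Arguments f2 {m}. Arguments f3 {m}. Arguments g1 {m}.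
Arguments g2 {m}. Arguments g3 {m}. Arguments w {m}.

Definition te_ends m (l : te_label m) : te_vertex m * te_vertex m :=
  match l with
  | e1 i => (v1, u i)
  | e2 i => (v2, u i)
  | f1 => (v1, x1)
  | f2 => (x1, x2)
  | f3 => (v1, x2)
  | g1 => (v2, y1)
  | g2 => (y1, y2)
  | g3 => (v2, y2)
  | w => (x1, y1)
  end.

Definition te_adj m (a b : te_vertex m) : Prop :=
  exists l : te_label m, te_ends l = (a, b) \/ te_ends l = (b, a).

(* An isomorphism from the standard two-ear graph G_m onto G. *)
Record te_labeling (m : nat) (G : sgraph) := TeLabeling {
  te_map :> te_vertex m -> G;
  te_bij : bijective te_map;
  te_adjP : forall a b, adj (te_map a) (te_map b) <-> te_adj a b
}.

Section TwoEarMonomials.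
Variables (m : nat) (G : sgraph) (phi : te_labeling m G).

Lemma te_edge_in (l : te_label m) :
  [set phi (te_ends l).1; phi (te_ends l).2] \in edge_set G.
Proof.
rewrite inE; apply/existsP; exists (phi (te_ends l).1).
apply/existsP; exists (phi (te_ends l).2); rewrite eqxx andbT.
by apply/te_adjP; exists l; left; case: (te_ends l).
Qed.

Definition te_edge (l : te_label m) : edge G := exist (fun e => e \in edge_set G) _ (te_edge_in l).

Definition te_var (l : te_label m) : 'X_{1..#|edge G|} :=
  U_(enum_rank (te_edge l))%MM.

Definition te_M1 (a : 'X_{1..#|edge G|}) : Prop :=
  exists i j : 'I_m.-1, (i < j)%N /\ a = (te_var (e1 i) + te_var (e2 j))%MM.

Definition te_M2 (a : 'X_{1..#|edge G|}) : Prop :=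
  a = (te_var f1 + te_var f2 + te_var g1 + te_var g2)%MM.

Definition te_M3 (a : 'X_{1..#|edge G|}) : Prop :=
  exists i : 'I_m.-1, a = (te_var g1 + te_var f2 + te_var (e1 i))%MM.

Definition te_M4 (a : 'X_{1..#|edge G|}) : Prop :=
  exists i : 'I_m.-1, a = (te_var g2 + te_var f1 + te_var (e2 i))%MM.

Definition te_M (a : 'X_{1..#|edge G|}) : Prop :=
  [\/ te_M1 a, te_M2 a, te_M3 a | te_M4 a].

End TwoEarMonomials.

(* Main.v *)
From HB Require Import structures.
Require Import Defs.
From mathcomp Require Import all_boot all_order all_algebra.
From mathcomp Require Import ring_quotient boolp.
From mathcomp Require Import mpoly.
From mathcomp Require Import zify ring.

(* The toric ideal I_G is the ideal of 2-minors of the 2 x (m+1) matrix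
       f1*g2   e_{1,1}  ...  e_{m-1,1}   w*f3
       w*g3    e_{1,2}  ...  e_{m-1,2}   f2*g1
   with rows (a_s) and (b_s), and the monomials in M are exactly the diagonal
   products a_s*b_t, s < t.  The Eagon-Northcott complex of the matrix has a
   basis whose elements are labelled by monomials; keeping only the part of the
   differentials that is homogeneous for these labels gives a complex resolving
   the initial ideal.  Both complexes are minimal and have the same
   ranks.  Their exactness has one proof: the leading terms of the differentials
   match the terms of consecutive modules perfectly, so that every cycle reduces
   to zero modulo boundaries.  In degree 0, the hypothesis on the initial ideal
   says that no nonzero element of I_G avoids the multiples of the a_s*b_t. *)

Set Implicit Arguments.
Unset Strict Implicit.
Unset Printing Implicit Defensive.

Import GRing.Theory.
Local Open Scope ring_scope.

(** * Invariance of Tor *)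

(** Passing to an initial ideal can raise Betti numbers strictly, so no general comparison gives the
    equality, and both resolutions are built. Their common rank in degree i >= 1 is i *
    binomial(m+1, i+1). Since [betti] reads its value off an arbitrary resolution, independence of
    the resolution has to be proved as well. One exactness proof serves both complexes thanks to a
    weight: a_s weighs 0 and b_s weighs s. In the Eagon-Northcott differential, every term that is
    not homogeneous for the labels has strictly smaller weight than the homogeneous ones, so both
    differentials have the same leading terms. Besides the weight, the matching rests on coprimality
    of certain entries. The variable [w], shared by the last top entry and the first bottom entry,
    does no harm: a top entry is compared only with bottom entries to its right. *)

Lemma row_action_eq (S : comNzRingType) p q (A B : 'M[S]_(p, q)) :
  (forall v : 'rV_p, v *m A = v *m B) -> A = B.
Proof. by move=> eqAB; apply/row_matrixP => j; rewrite !rowE eqAB. Qed.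

(** Projectivity of free modules: it is enough to lift the images of the basis vectors, which are
    the rows of [A]. *)
Lemma mulmx_lift (S : comNzRingType) p q r (A : 'M[S]_(p, r)) (B : 'M[S]_(q, r)) :
  (forall v : 'rV_p, exists w : 'rV_q, v *m A = w *m B) ->
  exists C : 'M_(p, q), C *m B = A.
Proof.
move=> liftA; have /choice[f fP] : forall j, exists w, row j A = w *m B.
  by move=> j; rewrite rowE; exact: liftA.
exists (\matrix_j f j); apply/row_matrixP => j.
by rewrite row_mul rowK fP.
Qed.

Section Comparison.
Variables (S : comNzRingType) (M : lmodType S).

Section Differential.
Variable F : free_resolution M.

Lemma res_dd i : res_d F i.+1 *m res_d F i = 0.
Proof.
apply: row_action_eq => v; rewrite mulmxA mulmx0.
by apply/res_exactS; exists v.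
Qed.

Lemma res_aug_d (v : 'rV_(res_rk F 1)) : res_aug F (v *m res_d F 0) = 0.
Proof. by apply/res_exact0; exists v. Qed.

End Differential.

Section ChainMap.
Variables F G : free_resolution M.

(** Invariant of the recursion that builds a chain map: it is what [mulmx_lift] needs to produce the
    next component, so it is carried along in a subset type. *)
Definition preserves_boundaries i (f : 'M[S]_(res_rk F i, res_rk G i)) : Prop :=
  forall v : 'rV_(res_rk F i.+1), exists w : 'rV_(res_rk G i.+1),
    v *m (res_d F i *m f) = w *m res_d G i.

Lemma chain_map_next i (f : {f | @preserves_boundaries i f}) :
  {f' | @preserves_boundaries i.+1 f' &
        f' *m res_d G i = res_d F i *m sval f}.
Proof.
case: f => f bf /=; apply: cid2.
have [f' f'P] := mulmx_lift bf; exists f' => // v.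
by apply/res_exactS; rewrite -!mulmxA f'P (mulmxA (res_d F i.+1)) res_dd mul0mx mulmx0.
Qed.

Fixpoint chain_map_from (f0 : {f | @preserves_boundaries 0 f}) i :
    {f | @preserves_boundaries i f} :=
  match i with
  | 0 => f0
  | j.+1 => let: exist2 f bf _ := chain_map_next (chain_map_from f0 j) in exist _ f bf
  end.

Lemma comparison : exists f : forall i, 'M[S]_(res_rk F i, res_rk G i),
  (forall v, res_aug G (v *m f 0) = res_aug F v) /\
  (forall i, f i.+1 *m res_d G i = res_d F i *m f i).
Proof.
have /choice[g gP] : forall j, exists w, res_aug G w = res_aug F (delta_mx 0 j).
  by move=> j; exact: res_aug_surj.
pose f0 := \matrix_j g j.
have augf0 v : res_aug G (v *m f0) = res_aug F v.
  rewrite [in RHS](row_sum_delta v) (mulmx_sum_row v f0) !linear_sum.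
  by apply: eq_bigr => j _; rewrite rowK !linearZ gP.
have bf0 : @preserves_boundaries 0 f0.
  by move=> v; apply/res_exact0; rewrite mulmxA augf0 res_aug_d.
pose f i := sval (chain_map_from (exist _ f0 bf0) i).
exists f; split=> // i.
by rewrite /f /=; case: (chain_map_next _).
Qed.

End ChainMap.

Section Homotopy.
Variable F : free_resolution M.
Variable f : forall i, 'M[S]_(res_rk F i, res_rk F i).
Hypothesis augf : forall v, res_aug F (v *m f 0) = 0.
Hypothesis chainf : forall i, f i.+1 *m res_d F i = res_d F i *m f i.

(** Makes [f i.+1 - res_d F i *m h] take values in the cycles, so that it lifts to the next homotopy
    component. *)
Let good i (h : 'M[S]_(res_rk F i, res_rk F i.+1)) : Prop :=
  res_d F i *m f i = res_d F i *m h *m res_d F i.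

Lemma homotopy_next i (h : {h | @good i h}) :
  {h' | @good i.+1 h' & f i.+1 = h' *m res_d F i.+1 + res_d F i *m sval h}.
Proof.
case: h => h gh /=; apply: cid2.
have [|h' h'P] :=
    @mulmx_lift _ _ _ _ (f i.+1 - res_d F i *m h) (res_d F i.+1).
  move=> v; apply/res_exactS.
  by rewrite -mulmxA mulmxBl chainf gh subrr mulmx0.
exists h'; last by rewrite h'P subrK.
by rewrite /good -mulmxA h'P mulmxBr mulmxA res_dd mul0mx subr0.
Qed.

Fixpoint homotopy_from (h0 : {h | @good 0 h}) i : {h | @good i h} :=
  match i with
  | 0 => h0
  | j.+1 => let: exist2 h gh _ := homotopy_next (homotopy_from h0 j) in exist _ h gh
  end.

Lemma null_homotopy : exists h : forall i, 'M[S]_(res_rk F i, res_rk F i.+1),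
  f 0 = h 0 *m res_d F 0 /\
  forall i, f i.+1 = h i.+1 *m res_d F i.+1 + res_d F i *m h i.
Proof.
have [|h0 h0P] := @mulmx_lift _ _ _ _ (f 0) (res_d F 0).
  by move=> v; apply/res_exact0; rewrite augf.
have gh0 : @good 0 h0 by rewrite /good -mulmxA h0P.
exists (fun i => sval (homotopy_from (exist _ h0 gh0) i)); split=> // i /=.
by case: (homotopy_next _).
Qed.

End Homotopy.
End Comparison.

(** The map from Z1 modulo B1 to Z2 modulo B2 induced by [f] is injective, because [g] brings each
    element of Z1 back to itself up to an element of B1. Multiplying by [C] realises the quotient by
    B2. *)
Lemma homology_rank_le (K : fieldType) p q z1 z2 b1 b2
    (f : 'M[K]_(p, q)) (g : 'M[K]_(q, p))
    (Z1 : 'M[K]_(z1, p)) (B1 : 'M[K]_(b1, p))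
    (Z2 : 'M[K]_(z2, q)) (B2 : 'M[K]_(b2, q)) :
  (Z1 *m f <= Z2)%MS -> (B2 <= Z2)%MS -> (B2 *m g <= B1)%MS ->
  (forall v : 'rV_p, (v <= Z1)%MS -> (v *m f *m g - v <= B1)%MS) ->
  (\rank Z1 - \rank B1 <= \rank Z2 - \rank B2)%N.
Proof.
move=> fZ BZ gB htpy; set C := cokermx B2.
have kerC r (A : 'M_(r, q)) : A *m C = 0 -> (A <= B2)%MS.
  by move=> AC0; rewrite submxE; apply/eqP.
have -> : (\rank Z2 - \rank B2)%N = \rank (Z2 *m C).
  rewrite -(mxrank_mul_ker Z2 C); have -> : \rank (Z2 :&: kermx C) = \rank B2.
    apply/eqP; rewrite eqn_leq; apply/andP; split; apply: mxrankS.
      apply: submx_trans (capmxSr _ _) _.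
      by apply: kerC; exact: mulmx_ker.
    rewrite sub_capmx BZ; apply/sub_kermxP; exact: mulmx_coker.
  by rewrite addnK.
apply: leq_trans (mxrankS (submxMr C fZ)).
rewrite -mulmxA leq_subLR -(mxrank_mul_ker Z1 (f *m C)) addnC leq_add2r.
apply: mxrankS; apply/row_subP => j; set v := row j _.
have : (v <= Z1 :&: kermx (f *m C))%MS by exact: row_sub.
rewrite sub_capmx => /andP[vZ /sub_kermxP]; rewrite mulmxA => /kerC vfB.
have -> : v = v *m f *m g - (v *m f *m g - v) by rewrite opprB addrC subrK.
apply: addmx_sub; first exact: submx_trans (submxMr g vfB) gB.
by rewrite eqmx_opp htpy.
Qed.

Section TorInvariance.
Variables (K : fieldType) (n : nat) (M : lmodType {mpoly K[n]}).

Local Notation map0 := (map_mx (mcoeff (0%MM : 'X_{1..n}))).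

Lemma res_dK_dd (F : free_resolution M) i :
  res_dK F i.+1 *m res_dK F i = 0.
Proof. by rewrite /res_dK -map_mxM res_dd map_mx0. Qed.

Lemma tor_dim_le (F G : free_resolution M) i :
  (tor_dim F i <= tor_dim G i)%N.
Proof.
have [f [augf chf]] := comparison F G; have [g [augg chg]] := comparison G F.
(* A chain endomorphism that lifts the zero map of [M], hence null-homotopic. *)
pose t i := f i *m g i - 1%:M.
have [|j|h [h0 hS]] := @null_homotopy _ _ F t.
- by move=> v; rewrite mulmxBr mulmxA mulmx1 linearB /= augg augf subrr.
- rewrite /t mulmxBl mulmxBr mul1mx mulmx1 -mulmxA chg !mulmxA chf.
  by [].
have map01 r : map0 (1%:M : 'M[{mpoly K[n]}]_r) = 1%:M by exact: map_mx1.
have bnd j : (res_dK G j *m map0 (g j) <= res_dK F j)%MS.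
  by rewrite /res_dK -map_mxM -chg map_mxM submxMl.
case: i => [|i] /=.
  have := @homology_rank_le K _ _ _ _ _ _ (map0 (f 0)) (map0 (g 0)) 1%:M
    (res_dK F 0) 1%:M (res_dK G 0).
  rewrite !mxrank1; apply; rewrite ?submx1 //.
  move=> v _; rewrite -mulmxA -map_mxM -{2}[v]mulmx1 -map01.
  by rewrite -mulmxBr -map_mxB -[_ - _]/(t 0) h0 map_mxM mulmxA submxMl.
apply: (homology_rank_le (f := map0 (f i.+1)) (g := map0 (g i.+1))) => //.
- apply/sub_kermxP; rewrite -mulmxA /res_dK -map_mxM chf map_mxM mulmxA.
  by rewrite mulmx_ker mul0mx.
- by apply/sub_kermxP; exact: res_dK_dd.
move=> v /sub_kermxP vd0.
rewrite -mulmxA -map_mxM -{2}[v]mulmx1 -map01.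
rewrite -mulmxBr -map_mxB -[_ - _]/(t i.+1) hS map_mxD !map_mxM mulmxDr.
by rewrite (mulmxA v (map0 (res_d F i))) vd0 mul0mx addr0 mulmxA submxMl.
Qed.

Lemma betti_minimal (F : free_resolution M) i :
  (forall j, res_dK F j = 0) -> betti M i = res_rk F i.
Proof.
move=> minF; have -> : betti M i = tor_dim F i.
  rewrite /betti; case: pselectT => [/(_ F)//|G].
  by apply/eqP; rewrite eqn_leq !tor_dim_le.
case: i => [|i] /=; first by rewrite minF mxrank0 subn0.
by rewrite !minF mxrank0 subn0 kermx0 mxrank1.
Qed.

End TorInvariance.

(** * Exactness from matchings of terms *)

Section Terms.
Variables (K : fieldType) (n : nat).
Local Notation S := {mpoly K[n]}.
Local Notation term r := ('X_{1..n} * 'I_r)%type.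

Definition tcoef r (v : 'rV[S]_r) (t : term r) : K := (v 0 t.2)@_t.1.

Definition termv r (t : term r) : 'rV[S]_r := 'X_[t.1] *: delta_mx 0 t.2.

Lemma tcoefE r (t t' : term r) : tcoef (termv t) t' = (t == t')%:R.
Proof.
case: t t' => [c x] [c' x']; rewrite /tcoef /termv !mxE eqxx /= xpair_eqE.
rewrite [x' == x]eq_sym; case: (x == x'); last by rewrite mulr0 mcoeff0 andbF.
by rewrite mulr1 mcoeffX andbT.
Qed.

Lemma tcoefD r (v w : 'rV[S]_r) t : tcoef (v + w) t = tcoef v t + tcoef w t.
Proof. by rewrite /tcoef mxE mcoeffD. Qed.

Lemma tcoefN r (v : 'rV[S]_r) t : tcoef (- v) t = - tcoef v t.
Proof. by rewrite /tcoef mxE mcoeffN. Qed.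

Lemma tcoefZ r (k : K) (v : 'rV[S]_r) t : tcoef (k%:MP *: v) t = k * tcoef v t.
Proof. by rewrite /tcoef mxE mcoeffCM. Qed.

Lemma term_sum r (v : 'rV[S]_r) :
  v = \sum_x \sum_(c <- msupp (v 0 x)) (tcoef v (c, x))%:MP *: termv (c, x).
Proof.
rewrite {1}(row_sum_delta v); apply: eq_bigr => x _.
rewrite {1}(mpolyE (v 0 x)) scaler_suml; apply: eq_bigr => c _.
by rewrite /termv /= scalerA mul_mpolyC.
Qed.

Lemma term_ind r (W : 'rV[S]_r -> Prop) :
    W 0 -> (forall v w, W v -> W w -> W (v + w)) ->
    (forall (k : K) v, W v -> W (k%:MP *: v)) ->
  forall v, (forall t, tcoef v t != 0 -> W (termv t)) -> W v.
Proof.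
move=> W0 WD WZ v Wt; rewrite (term_sum v).
apply: (big_ind W) => // x _; rewrite big_seq; apply: (big_ind W) => // c cv.
by apply/WZ/Wt; rewrite /tcoef -mcoeff_msupp.
Qed.

Lemma tcoef_mulmx r s (v : 'rV[S]_r) (D : 'M_(r, s)) t :
  tcoef (v *m D) t = \sum_x \sum_(c <- msupp (v 0 x))
    tcoef v (c, x) * tcoef (termv (c, x) *m D) t.
Proof.
rewrite [in LHS](term_sum v) mulmx_suml /tcoef summxE raddf_sum /=.
apply: eq_bigr => x _; rewrite mulmx_suml summxE raddf_sum /=.
by apply: eq_bigr => c _; rewrite -scalemxAl mxE mcoeffCM.
Qed.

(* [t] is the leading term, with respect to [key], of the image of [a]. *)
Definition leads r s (D : 'M[S]_(r, s)) (key : term s -> nat)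
    (a : term r) (t : term s) : Prop :=
  tcoef (termv a *m D) t != 0 /\
  forall t', t' != t -> tcoef (termv a *m D) t' != 0 -> (key t' < key t)%N.

(** Division algorithm: a term outside [src] is cancelled by an image that it leads, at the cost of
    terms with smaller key. *)
Lemma reduce_terms r s (D : 'M[S]_(r, s)) (key : term s -> nat)
    (src : term s -> Prop) :
    (forall t, src t \/ exists a, leads D key a t) ->
  forall v, exists w, forall t, tcoef (v - w *m D) t != 0 -> src t.
Proof.
move=> cover; pose W v := exists w, forall t, tcoef (v - w *m D) t != 0 -> src t.
have W0 : W 0 by exists 0 => t; rewrite mul0mx subr0 /tcoef mxE mcoeff0 eqxx.
have WD v v' : W v -> W v' -> W (v + v').
  case=> [w wP] [w' w'P]; exists (w + w') => t.
  rewrite mulmxDl opprD addrACA tcoefD.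
  have [->|/wP//] := eqVneq (tcoef (v - w *m D) t) 0.
  by rewrite add0r => /w'P.
have WZ (k : K) v : W v -> W (k%:MP *: v).
  case=> w wP; exists (k%:MP *: w) => t.
  by rewrite -scalemxAl -scalerBr tcoefZ mulf_eq0 negb_or => /andP[_ /wP].
have WD' w : W (w *m D) by exists w => t; rewrite subrr /tcoef mxE mcoeff0 eqxx.
have Wt t : W (termv t).
  have [N] := ubnP (key t); elim: N t => // N IHN t; rewrite ltnS => ktN.
  case: (cover t) => [st|[a [at_n0 low]]].
    exists 0 => t'; rewrite mul0mx subr0 tcoefE.
    by have [<-|_] := eqVneq t t'; last by rewrite eqxx.
  set v := termv a *m D in at_n0 low; set u := tcoef v t in at_n0.
  rewrite -(subrK (u^-1%:MP *: v) (termv t)); apply: (WD); last exact/WZ/WD'.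
  apply: (term_ind W0 WD WZ) => t'; rewrite tcoefD tcoefN tcoefZ tcoefE.
  have [<-|nt'] := eqVneq t t'; first by rewrite mulVf ?subrr ?eqxx.
  rewrite sub0r oppr_eq0 mulf_eq0 negb_or => /andP[_ vt'].
  apply: IHN; apply: leq_trans ktN; apply: low => //; by rewrite eq_sym.
by move=> v; exact: (term_ind W0 WD WZ).
Qed.

(** Among the leading terms of the images of the terms of [v], one with the largest key receives a
    single contribution, so it cannot cancel in [v *m D]. *)
Lemma kernel_src_eq0 r s (D : 'M[S]_(r, s)) (key : term s -> nat)
    (src : term r -> Prop) (ld : term r -> term s -> Prop) :
    (forall a, src a -> exists t, ld a t) ->
    (forall a t, src a -> ld a t -> leads D key a t) ->
    (forall a a' t, src a -> src a' -> ld a t -> ld a' t -> a = a') ->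
  forall v, (forall a, tcoef v a != 0 -> src a) -> v *m D = 0 -> v = 0.
Proof.
move=> ld_ex ld_lead ld_inj v v_src vD0.
have v_eq0 : (forall a, tcoef v a = 0) -> v = 0.
  move=> va0; apply/matrixP => i x; rewrite ord1 mxE; apply/mpolyP => c.
  by rewrite mcoeff0 -[RHS](va0 (c, x)).
(* [t0] is a default value for the choice function [f] at terms with zero coefficient. *)
have [/v_eq0//|/existsNP[a0 /eqP/v_src/ld_ex[t0 _]]] :=
  pselect (forall a, tcoef v a = 0).
have ex_ld a : exists t, tcoef v a != 0 -> ld a t.
  have [va0|/v_src/ld_ex[t at_ld]] := eqVneq (tcoef v a) 0; last by exists t.
  by exists t0 => /eqP.
have /choice[f fP] := ex_ld.
suff bound N : (forall a, tcoef v a != 0 -> (key (f a) < N)%N) -> v = 0.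
  apply: (bound (\max_(x < r) \max_(c <- msupp (v ord0 x)) key (f (c, x))).+1%N) => -[c x] vcx.
  rewrite ltnS; apply: leq_trans (leq_bigmax x).
  have cv : c \in msupp (v ord0 x) by rewrite mcoeff_msupp.
  exact: (@leq_bigmax_seq _ _ xpredT (fun c => key (f (c, x)))).
elim: N => [|N IHN] ltN.
  by apply: v_eq0 => a; apply/eqP/negPn/negP => /ltN.
apply: IHN => -[c x] vcx; have := ltN _ vcx; rewrite ltnS leq_eqVlt => /predU1P[kN|//].
set t := f (c, x) in kN; have ldt : ld (c, x) t by exact: fP.
have src_cx := v_src _ vcx; have [cx_t _] := ld_lead _ _ src_cx ldt.
have other a : a != (c, x) -> tcoef v a * tcoef (termv a *m D) t = 0.
  have [->|va] := eqVneq (tcoef v a) 0; first by rewrite mul0r.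
  move=> ne_a; suff -> : tcoef (termv a *m D) t = 0 by rewrite mulr0.
  apply/eqP/negPn/negP => at_n0; have [_ low] := ld_lead _ _ (v_src _ va) (fP _ va).
  have [eqt|ne_t] := eqVneq t (f a).
    case/eqP: ne_a; apply: ld_inj (v_src _ va) src_cx _ ldt.
    by rewrite eqt; exact: fP.
  by have := leq_trans (low _ ne_t at_n0) (ltN _ va); rewrite kN ltnn.
have := tcoef_mulmx v D t; rewrite vD0 {1}/tcoef mxE mcoeff0 (bigD1 x) //=.
rewrite [X in _ + X]big1 => [|y ne_yx]; last first.
  by apply: big1 => c' _; apply: other; rewrite xpair_eqE negb_and ne_yx orbT.
rewrite (bigD1_seq c) ?msupp_uniq ?mcoeff_msupp //= big1 => [|c' ne_c]; last first.
  by apply: other; rewrite xpair_eqE negb_and ne_c.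
by rewrite !addr0 => /esym/eqP; rewrite mulf_eq0 (negPf vcx) (negPf cx_t).
Qed.

Lemma exact_of_leads q r s (D' : 'M[S]_(q, r)) (D : 'M[S]_(r, s))
    (key' : term r -> nat) (key : term s -> nat)
    (src : term r -> Prop) (ld : term r -> term s -> Prop) :
    D' *m D = 0 ->
    (forall t, src t \/ exists a, leads D' key' a t) ->
    (forall a, src a -> exists t, ld a t) ->
    (forall a t, src a -> ld a t -> leads D key a t) ->
    (forall a a' t, src a -> src a' -> ld a t -> ld a' t -> a = a') ->
  forall v : 'rV_r, v *m D = 0 <-> exists w, v = w *m D'.
Proof.
move=> D'D cover ld_ex ld_lead ld_inj v; split=> [vD|[w ->]]; last first.
  by rewrite -mulmxA D'D mulmx0.
have [w wP] := reduce_terms cover v; exists w; apply/eqP; rewrite -subr_eq0.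
apply/eqP; apply: (kernel_src_eq0 ld_ex ld_lead ld_inj wP).
by rewrite mulmxBl vD -mulmxA D'D mulmx0 subr0.
Qed.

End Terms.
Arguments termv {K n r} t.

(** * The Eagon-Northcott complex and its degeneration *)

Section Position.
Variable N : nat.
Implicit Types (T : {set 'I_N}) (s t : 'I_N).

(** The [r] largest elements of [T] are those with [pos T t < r]; the parity of [pos T t] also gives
    the sign of a face. *)
Definition pos T t : nat := #|[set x in T | (t < x)%N]|.

Lemma pos_rem T s t : t \in T -> pos T s = ((s < t) + pos (T :\ t) s)%N.
Proof.
move=> tT; rewrite /pos (cardsD1 t) !inE tT; congr (_ + _)%N.
by apply: eq_card => x; rewrite !inE andbA.
Qed.

Lemma pos_homo T s t : (s <= t)%N -> (pos T t <= pos T s)%N.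
Proof.
move=> st; apply/subset_leq_card/subsetP => x; rewrite !inE => /andP[->] /=.
exact: leq_ltn_trans.
Qed.

Lemma pos_lt T s t : t \in T -> (s < t)%N -> (pos T t < pos T s)%N.
Proof.
move=> tT st; rewrite (pos_rem s tT) st (pos_rem t tT) ltnn add1n ltnS add0n.
by apply: pos_homo; exact: ltnW.
Qed.

Lemma pos_gt0 T t : (0 < pos T t)%N -> exists2 u, u \in T & (t < u)%N.
Proof. by case/card_gt0P=> u; rewrite inE => /andP[]; exists u. Qed.

Lemma pos_min T s :
  s \in T -> (forall x, x \in T -> (s <= x)%N) -> (pos T s).+1 = #|T|.
Proof.
move=> sT smin; rewrite (cardsD1 s) sT; congr _.+1; apply: eq_card => x.
rewrite !inE; have [xT|] := boolP (x \in T); rewrite ?andbF //= andbT.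
by rewrite ltn_neqAle smin // andbT eq_sym.
Qed.

Lemma pos_min_ge T s r : s \in T -> (forall x, x \in T -> (s <= x)%N) ->
  (r < #|T|)%N -> (r <= pos T s)%N.
Proof. by move=> sT smin; rewrite -(pos_min sT smin) ltnS. Qed.

Lemma pos_max T t : (forall x, x \in T -> (x <= t)%N) -> pos T t = 0%N.
Proof.
move=> tmax; apply: eq_card0 => x; rewrite !inE; apply/negbTE/negP.
by case/andP=> /tmax; rewrite leqNgt => /negbTE->.
Qed.

(* The sum of the [r] largest elements of [T], when [r <= #|T|]. *)
Definition top_sum T (r : nat) : nat := (\sum_(v < N) minn r (pos T v))%N.

(** Puts [t] in the form of [top_sum], whose summand at [v] counts those of the [r] largest elements
    that exceed [v]. *)
Lemma sum_lt_ord t : (\sum_(v < N) (v < t) = t)%N.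
Proof.
rewrite -(big_mkord xpredT (fun v => (v < t : nat)%N)) /=.
rewrite (@big_cat_nat _ _ _ t) ?(ltnW (ltn_ord t)) //=.
rewrite (eq_big_nat _ _ (F2 := fun=> 1%N)) => [|v /andP[_ ->]] //.
rewrite sum_nat_const_nat subn0 muln1 big_nat big1 ?addn0 // => v /andP[tv _].
by rewrite ltnNge tv.
Qed.

Lemma ltn_sum_ord (E F : 'I_N -> nat) t :
  (forall v, (E v <= F v)%N) -> (E t < F t)%N ->
  (\sum_v E v < \sum_v F v)%N.
Proof.
move=> leEF ltEF; rewrite (bigD1 t) //= [in X in (_ < X)%N](bigD1 t) //=.
by rewrite -addSn leq_add // leq_sum.
Qed.

Lemma top_sum_rem_low T r t : t \in T -> (r <= pos T t)%N ->
  top_sum (T :\ t) r = top_sum T r.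
Proof.
move=> tT rt; apply: eq_bigr => v _; have := pos_rem v tT.
have [vt|] := ltnP v t; last by move=> _ ->.
by have := pos_lt tT vt; lia.
Qed.

(** A smaller element, available because [r < #|T|], replaces [t] among the [r] largest. *)
Lemma top_sum_rem_lt T r t : t \in T -> (pos T t < r)%N -> (r < #|T|)%N ->
  (top_sum (T :\ t) r < top_sum T r)%N.
Proof.
move=> tT tr rT; have t_gt0 : (0 < t)%N.
  rewrite lt0n; apply/eqP => t0.
  by have := @pos_min T t tT; rewrite t0 => /(_ (fun _ _ => isT)); lia.
have t'N : (t.-1 < N)%N by have := ltn_ord t; lia.
(* The summand at t - 1 drops: at most [pos T t + 1 <= r] elements exceed t - 1, and [t] is one of
   them. *)
apply: (@ltn_sum_ord _ _ (Ordinal t'N)) => [v|]; first by have := pos_rem v tT; lia.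
have := pos_rem (Ordinal t'N) tT; rewrite /= prednK // leqnn.
suff : (pos T (Ordinal t'N) <= (pos T t).+1)%N by lia.
rewrite (pos_rem (Ordinal t'N) tT) (pos_rem t tT) ltnn /= prednK // leqnn add1n ltnS.
apply/subset_leq_card/subsetP => x; rewrite !inE /= => /andP[/andP[xt ->]] /=.
rewrite xt /= prednK // leq_eqVlt => /predU1P[tx|//].
by case/eqP: xt; apply: val_inj.
Qed.

Lemma top_sum_rem_high T r t : t \in T -> (pos T t < r)%N ->
  (top_sum (T :\ t) r.-1 + t)%N = top_sum T r.
Proof.
move=> tT tr; rewrite -{1}(sum_lt_ord t) -big_split /=; apply: eq_bigr => v _.
have := pos_rem v tT; have [vt|tv] := ltnP v t; first by lia.
by have := pos_homo T tv; lia.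
Qed.

(** On the left, [t] stands in for the [r]-th largest element of [T], which is greater than [t]. *)
Lemma top_sum_rem_high_lt T r t : t \in T -> (0 < r <= pos T t)%N ->
  (top_sum (T :\ t) r.-1 + t < top_sum T r)%N.
Proof.
move=> tT rt; rewrite -{1}(sum_lt_ord t) -big_split /=.
apply: (@ltn_sum_ord _ _ t) => [v|].
  by have := pos_rem v tT; have [vt|tv] := ltnP v t; lia.
by have := pos_rem t tT; rewrite ltnn; lia.
Qed.

End Position.

Lemma sum_step (S : comNzRingType) N r (U V W : nat -> S) : (r <= N)%N ->
  \sum_(r' < N.+1) ((r' == r :> nat)%:R * U r' + (r'.+1 == r)%:R * V r') * W r' =
  U r * W r + (0 < r)%:R * V r.-1 * W r.-1.
Proof.
move=> rN; under eq_bigr do rewrite mulrDl.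
rewrite big_split /= (bigD1 (Ordinal (rN : (r < N.+1)%N))) //= eqxx mul1r.
rewrite big1 ?addr0 => [|i ne_i]; last first.
  by rewrite (_ : (_ == r) = false) ?mul0r //; apply/negbTE; exact: ne_i.
congr (_ + _); case: r rN => [|r] rN.
  by rewrite !mul0r big1 // => i _; rewrite mul0r mul0r.
rewrite mul1r (bigD1 (Ordinal (ltnW rN : (r < N.+1)%N))) //= eqxx mul1r.
rewrite big1 ?addr0 // => i ne_i.
by rewrite (_ : (_ == r.+1) = false) ?mul0r //; apply/negbTE; exact: ne_i.
Qed.

(** * Cells, differentials and the relation d d = 0 *)

Section Complex.
Variables (K : fieldType) (n N : nat) (a b : 'I_N -> 'X_{1..n}) (eps : bool).
Local Notation S := {mpoly K[n]}.
Local Notation cell := ({set 'I_N} * 'I_N.+1)%type.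
Implicit Types (T : {set 'I_N}) (s t : 'I_N) (x y z : cell).

(* [eps = true] gives the Eagon-Northcott complex of the 2 x N matrix with rows [a]
   and [b], and [eps = false] its degeneration.  A cell [(T, r)] stands for
   e_T (x) u^(#|T| - 1 - r) v^(r - 1) and is labelled by the monomial in which the
   [r] largest elements of [T] carry [b] and the others carry [a]. *)
Definition hasA T r t : bool := eps || (r <= pos T t)%N.
Definition hasB T r t : bool := eps || (pos T t < r)%N.

Definition face T (r r' : nat) t : S :=
  (-1) ^+ pos T t * ((r' == r)%:R * ((hasA T r t)%:R * 'X_[a t])
                     + (r'.+1 == r)%:R * ((hasB T r t)%:R * 'X_[b t])).

Definition incidence x y : S :=
  \sum_(t in x.1 | y.1 == x.1 :\ t) face x.1 x.2 y.2 t.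

Definition minor T : S :=
  \sum_(s in T) \sum_(t in T | (s < t)%N)
    ('X_[a s + b t] - eps%:R * 'X_[a t + b s]).

Lemma incidence_face T t r y : t \in T -> y.1 = T :\ t ->
  incidence (T, r) y = face T r y.2 t.
Proof.
move=> tT yT; rewrite /incidence /= (big_pred1 t) // => s /=; rewrite yT.
apply/andP/eqP => [[sT /eqP/setP/(_ s)]|->]; last by [].
by rewrite !inE eqxx /= sT andbT => /negbFE/eqP.
Qed.

Lemma incidence_neq0 x y : incidence x y != 0 ->
  exists2 t, t \in x.1 /\ y.1 = x.1 :\ t &
    (y.2 = x.2 :> nat) \/ (y.2.+1 = x.2 :> nat).
Proof.
move=> d_n0; have [t /andP[tT /eqP yT]|no_t] :=
  pickP (fun t => (t \in x.1) && (y.1 == x.1 :\ t)); last first.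
  by case/eqP: d_n0; rewrite /incidence big_pred0.
exists t => //; move: d_n0; case: x tT yT => T r /= tT yT.
rewrite (incidence_face r tT yT) /face.
have [->|_] := eqVneq (y.2 : nat) r; first by left.
have [->|_] := eqVneq y.2.+1 (r : nat); first by right.
by rewrite !mul0r addr0 mulr0 eqxx.
Qed.

(** Removing two indices in either order gives the same monomials with opposite signs. *)
Lemma face_face T r r'' s t : s \in T -> t \in T -> s != t -> (r <= N)%N ->
  \sum_(r' < N.+1) face T r r' t * face (T :\ t) r' r'' s =
  - (\sum_(r' < N.+1) face T r r' s * face (T :\ s) r' r'' t).
Proof.
move=> sT tT; wlog st : s t sT tT / (s < t)%N => [IH ne_st rN|_ rN].
  have [/IH->//|ts|/val_inj eq_st] := ltngtP s t; last by rewrite eq_st eqxx in ne_st.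
  by rewrite [in RHS]IH ?opprK // eq_sym.
pose sum u v := \sum_(r' < N.+1) face T r r' u * face (T :\ u) r' r'' v.
(* Four products aa, ab, ba, bb; exchanging [u] and [v] swaps the two middle ones. *)
have sumE u v : sum u v = (-1) ^+ (pos T u + pos (T :\ u) v) *
   ([&& hasA T r u, r'' == r & hasA (T :\ u) r v]%:R * ('X_[a u] * 'X_[a v])
  + [&& hasA T r u, r''.+1 == r & hasB (T :\ u) r v]%:R * ('X_[a u] * 'X_[b v])
  + [&& (0 < r)%N, hasB T r u, r'' == r.-1 & hasA (T :\ u) r.-1 v]%:R
      * ('X_[b u] * 'X_[a v])
  + [&& (0 < r)%N, hasB T r u, r''.+1 == r.-1 & hasB (T :\ u) r.-1 v]%:R
      * ('X_[b u] * 'X_[b v])).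
  rewrite /sum; under eq_bigr => r' _ do rewrite /face -[_ * _ * _]mulrA.
  rewrite -mulr_sumr (sum_step (fun=> (hasA T r u)%:R * 'X_[a u])
    (fun=> (hasB T r u)%:R * 'X_[b u])
    (fun r' => face (T :\ u) r' r'' v)) // /face exprD -mulnb.
  by rewrite -!mulnb !natrM; ring.
rewrite -/(sum t s) -/(sum s t) !sumE.
have post := pos_rem t sT; have poss := pos_rem s tT; rewrite st in poss.
rewrite ltnNge (ltnW st) /= add0n in post.
have lt_pos := pos_lt tT st.
(* Removing the larger index [t] lowers [pos] at [s] by one, while removing [s] leaves [pos] at [t]
   unchanged: the signs are opposite. *)
have -> : (pos T t + pos (T :\ t) s = (pos T t + pos T s).-1)%N by lia.
have -> : (pos T s + pos (T :\ s) t = (pos T t + pos T s).-1.+1)%N by lia.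
rewrite exprS mulN1r mulNr opprK; congr (_ * _).
rewrite /hasA /hasB -post.
have -> : pos (T :\ t) s = (pos T s).-1 by lia.
rewrite (mulrC 'X_[a t] 'X_[a s]) (mulrC 'X_[b t] 'X_[b s]).
rewrite (mulrC 'X_[a t] 'X_[b s]) (mulrC 'X_[b t] 'X_[a s]).
congr (_ + _%:R * _); last by case: (eps); lia.
rewrite -!addrA; congr (_%:R * _ + _); first by case: (eps); lia.
by rewrite addrC; congr (_%:R * _ + _%:R * _); case: (eps); lia.
Qed.

(** The sum runs over ordered pairs of removed indices, which cancel two by two. The middle cell is
    arbitrary here; [cx_dd] restricts it to the basis. *)
Lemma sum_incidence x y : \sum_z incidence x z * incidence z y = 0.
Proof.
case: x y => T r [T'' r''].
pose G t s := \sum_(r' < N.+1) face T r r' t * face (T :\ t) r' r'' s.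
have -> : \sum_z incidence (T, r) z * incidence z (T'', r'') =
    \sum_(t in T) \sum_(s in T :\ t | T'' == T :\ t :\ s) G t s.
  rewrite -(pair_bigA _ (fun T' r' => incidence (T, r) (T', r') *
     incidence (T', r') (T'', r''))) /=.
  transitivity (\sum_T' \sum_(r' < N.+1) \sum_(t in T | T' == T :\ t)
      face T r r' t * incidence (T', r') (T'', r'')).
    by apply: eq_bigr => T' _; apply: eq_bigr => r' _; rewrite -mulr_suml.
  under [LHS]eq_bigr => T' _ do rewrite exchange_big /=.
  rewrite (exchange_big_dep (mem T)) /=; last by move=> ? ? _ /andP[].
  apply: eq_bigr => t tT.
  rewrite (big_pred1 (T :\ t)); last by move=> T' /=; rewrite tT.
  rewrite /G [in RHS]exchange_big /=; apply: eq_bigr => r' _.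
  by rewrite /incidence /= mulr_sumr.
have -> : \sum_(t in T) \sum_(s in T :\ t | T'' == T :\ t :\ s) G t s =
    \sum_(t in T) \sum_(s in T | (s < t)%N && (T'' == T :\ t :\ s)) G t s
  + \sum_(t in T) \sum_(s in T | (t < s)%N && (T'' == T :\ t :\ s)) G t s.
  rewrite -big_split /=; apply: eq_bigr => t tT.
  rewrite (bigID (fun s : 'I_N => (s < t)%N)) /=.
  congr (_ + _); apply: eq_bigl => s; rewrite !inE.
    have [st|] := ltnP s t; rewrite ?andbF ?andbT //.
    by rewrite -(inj_eq val_inj) /= neq_ltn st.
  rewrite -leqNgt -(inj_eq val_inj) /= neq_ltn.
  by have [st|ts|st] := ltngtP s t; rewrite ?andbF //= ?andbT.
rewrite [X in _ + X](exchange_big_dep (mem T)) /=; last by move=> ? ? _ /andP[].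
rewrite -big_split big1 //= => t tT; apply/eqP; rewrite addr_eq0; apply/eqP.
rewrite -sumrN; apply: eq_big => [s|s /and3P[sT st _]].
  rewrite tT /=; congr (_ && (_ && _)); congr (_ == _).
  by apply/setP => u; rewrite !inE andbCA.
by rewrite /G face_face // ?(leq_ord r) // neq_ltn st.
Qed.

Lemma cards3_sorted T : #|T| = 3%N ->
  exists p q s : 'I_N, [/\ (p < q)%N, (q < s)%N & T = [set p; q; s]].
Proof.
move=> T3; have /card_gt0P[p0 p0T] : (0 < #|T|)%N by rewrite T3.
case: (arg_minnP (fun p : 'I_N => p : nat) p0T) => p pT pmin; have {}pT : p \in T := pT.
have /eqP/cards2P[q [s [ne_qs Tp]]] : #|T :\ p| = 2%N.
  by move: T3; rewrite (cardsD1 p) pT => -[].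
wlog qs : q s ne_qs Tp / (q < s)%N.
  have [qs|sq|/val_inj eq_qs] := ltngtP q s; last by rewrite eq_qs eqxx in ne_qs.
    by move/(_ q s); exact.
  by move/(_ s q); apply; rewrite // ?(eq_sym s) ?Tp // setUC.
exists p, q, s; split=> //; last by rewrite -setUA -Tp setD1K.
have : q \in T :\ p by rewrite Tp !inE eqxx.
rewrite !inE => /andP[ne_qp /pmin]; rewrite leq_eqVlt => /predU1P[/val_inj eq_qp|//].
by rewrite eq_qp eqxx in ne_qp.
Qed.

Lemma minor_pair s t : (s < t)%N ->
  minor [set s; t] = 'X_[a s + b t] - eps%:R * 'X_[a t + b s].
Proof.
move=> st; have ne_st : s != t by rewrite neq_ltn st.
have inner u (F : 'I_N -> S) : \sum_(v in [set s; t] | (u < v)%N) F v =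
    (if (u < s)%N then F s else 0) + (if (u < t)%N then F t else 0).
  by rewrite big_mkcondr big_setU1 ?inE // big_set1.
by rewrite /minor big_setU1 ?inE // big_set1 !inner !ltnn st ltnNge ltnW //= !addr0 add0r.
Qed.

(** Expansion of a 3 x 3 determinant with a repeated row, row [a] for r = 1 and row [b] for r = 2.
    For [eps = false] two terms survive, and they cancel. *)
Lemma sum_face_minor T (r : nat) : #|T| = 3%N -> (0 < r <= 2)%N ->
  \sum_(t in T) face T r 1 t * minor (T :\ t) = 0.
Proof.
case/cards3_sorted=> p [q [s [pq qs T_def]]] r12; have ps := ltn_trans pq qs.
have [npq nqs nps] : [/\ p != q, q != s & p != s] by rewrite !neq_ltn pq qs ps.
have Ts : T :\ s = [set p; q].
  by rewrite T_def setUC setU1K // !inE negb_or ![s == _]eq_sym nps.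
have Tq : T :\ q = [set p; s].
  by rewrite T_def setUAC setUC setU1K // !inE negb_or [q == _]eq_sym npq.
have Tp : T :\ p = [set q; s] by rewrite T_def -setUA setU1K // !inE negb_or npq.
have pos_s : pos T s = 0%N.
  by apply: pos_max => u; rewrite T_def !inE => /orP[/orP[]|] /eqP ->; lia.
have pos_q : pos T q = 1%N.
  rewrite (@pos_rem _ T q s) ?T_def ?inE ?eqxx ?orbT // -T_def qs Ts pos_max // => u.
  by rewrite !inE => /orP[] /eqP ->; lia.
have pos_p : pos T p = 2%N.
  rewrite (@pos_rem _ T p s) ?T_def ?inE ?eqxx ?orbT // -T_def ps Ts.
  rewrite (@pos_rem _ [set p; q] p q) ?inE ?eqxx ?orbT // pq pos_max // => u.
  by rewrite !inE => /andP[/negbTE ->]; rewrite orbF => /eqP ->.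
rewrite {1}T_def -setUA !big_setU1 ?inE ?negb_or ?npq ?nps // big_set1 Ts Tq Tp.
rewrite !minor_pair // /face /hasA /hasB pos_s pos_q pos_p !mpolyXD.
by case: r r12 => [|[|[|r]]] //= _; case: (eps) => /=; ring.
Qed.

(* In degree 0 the pair [(set0, 0)] is a dummy name for the only basis element. *)
Definition cells (i : nat) : {set cell} :=
  [set x : cell | (#|x.1| == i.+1) && (0 < x.2 <= i)%N || ((i == 0)%N && (x == (set0, ord0)))].

Lemma cellsS i x : (x \in cells i.+1) = (#|x.1| == i.+2) && (0 < x.2 <= i.+1)%N.
Proof. by rewrite inE orbF. Qed.

Lemma cells0 x : (x \in cells 0) = (x == (set0, ord0)).
Proof. by rewrite inE /= (_ : (0 < x.2 <= 0)%N = false) ?andbF //; case: (x.2 : nat). Qed.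

Definition cx_d i : 'M[S]_(#|cells i.+1|, #|cells i|) :=
  \matrix_(j, k) if i is 0 then minor (enum_val j).1
                 else incidence (enum_val j) (enum_val k).

Lemma cx_dd i : cx_d i.+1 *m cx_d i = 0.
Proof.
apply/matrixP => j k; rewrite !mxE.
case: i j k => [|i] j k; under eq_bigr do rewrite !mxE.
  rewrite -(big_enum_val (fun z => incidence (enum_val j) z * minor z.1)) /=.
  have := enum_valP j; case: (enum_val j) => T r; rewrite cellsS /= => /andP[/eqP T3 r12].
  have N1 : (1 < N.+1)%N by have := max_card (mem T); rewrite T3 card_ord; lia.
  rewrite (eq_bigl (fun z : cell => (#|z.1| == 2) && (z.2 == Ordinal N1))); last first.
    by move=> z /=; rewrite cellsS -val_eqE /=; congr (_ && _); lia.
  rewrite -(pair_big (fun T' : {set 'I_N} => #|T'| == 2) (pred1 (Ordinal N1))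
    (fun T' r' => incidence (T, r) (T', r') * minor T')) /=.
  under eq_bigr do rewrite big_pred1_eq mulr_suml /=.
  rewrite (exchange_big_dep (mem T)) /=; last by move=> ? ? _ /andP[].
  rewrite -[RHS](sum_face_minor T3 r12); apply: eq_bigr => t tT.
  have Tt2 : #|T :\ t| = 2%N by move: T3; rewrite (cardsD1 t) tT => -[].
  rewrite (big_pred1 (T :\ t)) // => T' /=; rewrite tT /=.
  by case: (T' =P T :\ t) => [->|]; rewrite ?andbF // Tt2.
rewrite -(big_enum_val (fun z => incidence (enum_val j) z * incidence z (enum_val k))) /=.
(* A face keeps the second component or lowers it by one, so a cell having a face in the basis is
   itself in the basis: no nonzero product is lost. *)
rewrite -[RHS](sum_incidence (enum_val j) (enum_val k)) [RHS](bigID (mem (cells i.+2))) /=.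
rewrite [X in _ + X]big1 ?addr0 // => z; apply: contraNeq.
rewrite mulf_eq0 negb_or => /andP[_ /incidence_neq0[t [tz zt] y2]].
have := enum_valP k; rewrite !cellsS zt => /andP[/eqP yi yr].
by rewrite (cardsD1 t) tz yi /=; lia.
Qed.

End Complex.

(** * Exactness of the two complexes *)

Definition coprime_mon n (m m' : 'X_{1..n}) : Prop :=
  forall j, m j = 0%N \/ m' j = 0%N.

Lemma coprime_mon_sym n (m m' : 'X_{1..n}) : coprime_mon m m' -> coprime_mon m' m.
Proof. by move=> cop j; case: (cop j); [right|left]. Qed.

Lemma coprime_mon_dvd n (m m' c : 'X_{1..n}) :
  coprime_mon m m' -> (m <= c + m')%MM -> (m <= c)%MM.
Proof.
move=> cop /mnm_lepP mcm'; apply/mnm_lepP => j; have := mcm' j; rewrite mnmDE.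
by case: (cop j) => ->; rewrite ?addn0.
Qed.

Section Exactness.
Variables (K : fieldType) (n N : nat) (a b : 'I_N -> 'X_{1..n}) (eps : bool).
Variable wt : 'X_{1..n} -> nat.
Hypothesis wtD : forall c c', wt (c + c')%MM = (wt c + wt c')%N.
Hypothesis wt_a : forall s, wt (a s) = 0%N.
Hypothesis wt_b : forall s, wt (b s) = s.
Hypothesis cop_aa : forall s t u : 'I_N, (s < t)%N -> (t < u)%N -> coprime_mon (a s) (a t).
(** The order matters: for two-ear graphs, [w] divides both the last top entry and the first bottom
    entry. *)
Hypothesis cop_ab : forall s t : 'I_N, (s < t)%N -> coprime_mon (a s) (b t).
Hypothesis cop_bb : forall u s t : 'I_N, (u < s)%N -> (s < t)%N -> coprime_mon (b s) (b t).

Local Notation S := {mpoly K[n]}.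
Local Notation cell := ({set 'I_N} * 'I_N.+1)%type.
Local Notation cx_d := (@cx_d K n N a b eps).
Local Notation face := (@face K n N a b eps).
Local Notation incidence := (@incidence K n N a b eps).
Implicit Types (T : {set 'I_N}) (s t : 'I_N) (x y z : cell) (c : 'X_{1..n}).

(* At [c * (T, r)], [has_low] and [has_high] say that the least index [s] with
   [a_s] dividing the multidegree is not in the [a]-part of [T], resp. that the
   greatest [t] with [b_t] dividing it is not in the [b]-part.  Terms are matched by
   adding or removing this [s] or, when the [a]-part is reduced to [s], this [t]. *)
Definition has_low c T : bool :=
  [exists s : 'I_N, [forall (u | u \in T), (s < u)%N] && (a s <= c)%MM].

Definition has_high c T : bool :=
  [exists t : 'I_N, [forall (u | u \in T), (u < t)%N] && (b t <= c)%MM].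

Lemma has_lowP c T :
  reflect (exists s : 'I_N, (forall u, u \in T -> (s < u)%N) /\ (a s <= c)%MM) (has_low c T).
Proof.
apply: (iffP existsP) => -[s].
  by case/andP=> /forall_inP sT asc; exists s.
by case=> sT asc; exists s; rewrite asc andbT; apply/forall_inP.
Qed.

Lemma has_highP c T :
  reflect (exists t : 'I_N, (forall u, u \in T -> (u < t)%N) /\ (b t <= c)%MM) (has_high c T).
Proof.
apply: (iffP existsP) => -[s].
  by case/andP=> /forall_inP sT asc; exists s.
by case=> sT asc; exists s; rewrite asc andbT; apply/forall_inP.
Qed.

(** Singles out the matched partner among image terms of equal weight: removing the least index
    creates a low index, removing the greatest a high one. *)
Definition tie_break c T : nat := if has_low c T then 2%N else has_high c T.

(** [top_sum] is the weight of the label of [x], so the sum is the weight of the multidegree; the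
    factor 3 makes it dominate [tie_break]. *)
Definition cell_key c x : nat :=
  (3 * (wt c + top_sum x.1 x.2) + tie_break c x.1)%N.

Definition key i (t : 'X_{1..n} * 'I_#|cells N i|) : nat :=
  cell_key t.1 (enum_val t.2).

(** The terms whose partner lies one degree lower. The test [x.2.+1 == #|x.1|] says that a single
    index carries [a]. *)
Definition source c x : bool :=
  ~~ has_low c x.1 && ((x.2.+1 == #|x.1|) ==> ~~ has_high c x.1).

(** When a single index carries [a], removing it would leave a cell outside the basis, so the
    greatest index is removed instead. *)
Definition lead_term c x c' y : Prop :=
  (exists s, [/\ s \in x.1, forall u, u \in x.1 -> (s <= u)%N, (x.2.+1 < #|x.1|)%N
      & [/\ y.1 = x.1 :\ s, y.2 = x.2 :> nat & c' = c + a s]%MM]) \/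
  (exists t, [/\ t \in x.1, forall u, u \in x.1 -> (u <= t)%N, x.2.+1 = #|x.1|
      & [/\ y.1 = x.1 :\ t, y.2.+1 = x.2 & c' = c + b t]%MM]).

Lemma tie_break_le2 c T : (tie_break c T <= 2)%N.
Proof. by rewrite /tie_break; case: ifP => // _; case: has_high. Qed.

Lemma tcoef_cx i c c' (j : 'I_#|cells N i.+1|) (k : 'I_#|cells N i|) :
  tcoef (termv (c, j) *m cx_d i) (c', k) = ('X_[c] * cx_d i j k)@_c'.
Proof. by rewrite /tcoef /termv /= -scalemxAl -rowE !mxE. Qed.

Lemma face_coef c c' T r r' t :
  ('X_[c] * face T r r' t)@_c' = (-1) ^+ pos T t *
    ([&& r' == r, hasA eps T r t & c + a t == c']%MM%:R
     + [&& r'.+1 == r, hasB eps T r t & c + b t == c']%MM%:R).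
Proof.
have coefX (B B' : bool) m : ('X_[c] * (B%:R * (B'%:R * 'X_[m])))@_c' =
    [&& B, B' & (c + m == c')%MM]%:R :> K.
  case: B; last by rewrite mul0r mulr0 mcoeff0.
  case: B'; last by rewrite mul0r !mulr0 mcoeff0.
  by rewrite !mul1r -mpolyXD mcoeffX.
rewrite /face -signr_odd mulr_sign -[in RHS]signr_odd mulr_sign.
by case: ifP => _; rewrite ?mulrN ?mcoeffN mulrDr mcoeffD !coefX.
Qed.

Lemma incidence_coef_neq0 c x c' y : ('X_[c] * incidence x y)@_c' != 0 ->
  exists2 t, t \in x.1 /\ y.1 = x.1 :\ t &
    [/\ y.2 = x.2 :> nat, hasA eps x.1 x.2 t & c' = (c + a t)%MM] \/
    [/\ y.2.+1 = x.2, hasB eps x.1 x.2 t & c' = (c + b t)%MM].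
Proof.
case: x => T r /= nz; have := incidence_neq0 (K := K) (a := a) (b := b) (eps := eps).
move=> /(_ (T, r) y)[|t [/= tT yT] _].
  by apply: contraNneq nz => ->; rewrite mulr0 mcoeff0.
exists t => //; move: nz; rewrite (incidence_face _ _ _ _ _ tT) // face_coef.
have [/and3P[/eqP -> ra /eqP <-] _|_] := boolP [&& y.2 == r :> nat, _ & _].
  by left.
have [/and3P[/eqP -> rb /eqP <-] _|_] := boolP [&& y.2.+1 == r :> nat, _ & _].
  by right.
by rewrite addr0 mulr0 eqxx.
Qed.

Lemma ex_min T : T != set0 -> exists2 s, s \in T & forall u, u \in T -> (s <= u)%N.
Proof.
case/set0Pn=> s0 s0T; case: (arg_minnP (fun u : 'I_N => u : nat) s0T) => s sT smin.
by exists s.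
Qed.

Lemma ex_max T : T != set0 -> exists2 t, t \in T & forall u, u \in T -> (u <= t)%N.
Proof.
case/set0Pn=> s0 s0T; case: (arg_maxnP (fun u : 'I_N => u : nat) s0T) => s sT smax.
by exists s.
Qed.

Lemma cell_key_lt c x c' y :
  (wt c + top_sum x.1 x.2 < wt c' + top_sum y.1 y.2)%N -> (cell_key c x < cell_key c' y)%N.
Proof. by rewrite /cell_key; have := tie_break_le2 c x.1; lia. Qed.

Lemma lead_term_weight c x c' y : (0 < x.2 < #|x.1|)%N -> lead_term c x c' y ->
  (wt c' + top_sum y.1 y.2 = wt c + top_sum x.1 x.2)%N.
Proof.
move=> x2 [[s [sT smin r2 [-> -> ->]]]|[t [tT tmax r1 [-> yr ->]]]].
  rewrite wtD wt_a addn0 top_sum_rem_low //; exact: (pos_min_ge sT smin (ltnW r2)).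
rewrite wtD wt_b -addnA (addnC (t : nat)).
have -> : y.2 = x.2.-1 :> nat by rewrite -yr.
by rewrite top_sum_rem_high // (pos_max tmax); case/andP: x2.
Qed.

(** Removing an index of the b-part through its a-entry, or the converse, strictly lowers the
    weight. What remains is the degenerate differential, whatever [eps] is. *)
Lemma incidence_weight c x c' y :
    (0 < x.2 < #|x.1|)%N -> ('X_[c] * incidence x y)@_c' != 0 ->
  (wt c' + top_sum y.1 y.2 < wt c + top_sum x.1 x.2)%N \/
  exists2 t, t \in x.1 /\ y.1 = x.1 :\ t &
    (wt c' + top_sum y.1 y.2 = wt c + top_sum x.1 x.2)%N /\
    ([/\ y.2 = x.2 :> nat, (x.2 <= pos x.1 t)%N & c' = (c + a t)%MM] \/
     [/\ y.2.+1 = x.2, (pos x.1 t < x.2)%N & c' = (c + b t)%MM]).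
Proof.
move=> /andP[x2_gt0 x2_lt] /incidence_coef_neq0[t [tT yT] yc].
case: yc => [[yr _ c'E]|[yr _ c'E]]; rewrite c'E wtD yT.
  rewrite yr wt_a addn0; have [low|high] := leqP x.2 (pos x.1 t).
    right; exists t => //; split; first by rewrite top_sum_rem_low.
    by left.
  by left; rewrite ltn_add2l top_sum_rem_lt.
rewrite wt_b -addnA (addnC (t : nat)).
have -> : y.2 = x.2.-1 :> nat by rewrite -yr.
have [low|high] := leqP x.2 (pos x.1 t).
  by left; rewrite ltn_add2l top_sum_rem_high_lt // x2_gt0.
right; exists t => //; split; first by rewrite top_sum_rem_high.
by right; rewrite prednK.
Qed.

(** Competitors of the leading term gain no low index: the least index [s] stays in the set, and no
    a_s' with s' < s shares a variable with the new factor [m]. *)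
Lemma no_low_rem c T s t m : ~~ has_low c T ->
    s \in T -> s != t -> (forall u, u \in T -> (s <= u)%N) ->
    (forall s' : 'I_N, (s' < s)%N -> coprime_mon (a s') m) ->
  ~~ has_low (c + m)%MM (T :\ t).
Proof.
move=> nlow sT st smin cop; apply: contra nlow => /has_lowP[s' [s'T as'c]].
have s's : (s' < s)%N by apply: s'T; rewrite !inE st.
apply/has_lowP; exists s'; split=> [u /smin|]; first exact: leq_trans.
exact: coprime_mon_dvd (cop _ s's) as'c.
Qed.

Lemma no_high_rem c T s t t0 : ~~ has_high c T -> t0 \in T -> t0 != t ->
    (forall u, u \in T -> (u <= t0)%N) -> (s < t)%N -> t \in T ->
  ~~ has_high (c + b t)%MM (T :\ t).
Proof.
move=> nhigh t0T t0t t0max st tT; apply: contra nhigh => /has_highP[t' [t'T bt'c]].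
have t0t' : (t0 < t')%N by apply: t'T; rewrite !inE t0t.
apply/has_highP; exists t'; split=> [u /t0max ut0|].
  exact: leq_ltn_trans ut0 t0t'.
apply: coprime_mon_dvd bt'c; apply: coprime_mon_sym; apply: cop_bb st _.
exact: leq_ltn_trans (t0max _ tT) t0t'.
Qed.

(** Terms of smaller weight lose at once. Among those of equal weight, only the removal made by
    [lead_term] creates a low index, respectively a high one: the source had none, and coprimality
    keeps the other removals from creating one. *)
Lemma leads_lead_term i c (j : 'I_#|cells N i.+2|) c' (k : 'I_#|cells N i.+1|) :
    source c (enum_val j) -> lead_term c (enum_val j) c' (enum_val k) ->
  leads (cx_d i.+1) (@key i.+1) (c, j) (c', k).
Proof.
have := enum_valP j; set x := enum_val j; rewrite cellsS => /andP[/eqP xT xr].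
have x2 : (0 < x.2 < #|x.1|)%N by case/andP: xr => -> /=; rewrite xT ltnS.
move=> src lead; split.
  rewrite tcoef_cx mxE -/x; case: lead => [[s [sT smin r2 [yT yr c'E]]]|].
    rewrite [x]surjective_pairing (incidence_face _ _ _ _ _ sT) // face_coef yr eqxx.
    rewrite [_.+1 == _]gtn_eqF // addr0 c'E eqxx andbT /hasA.
    have -> : (x.2 <= pos x.1 s)%N by exact: (pos_min_ge sT smin (ltnW r2)).
    by rewrite orbT mulr1 signr_eq0.
  case=> t [tT tmax r1 [yT yr c'E]].
  rewrite [x]surjective_pairing (incidence_face _ _ _ _ _ tT) // face_coef yr eqxx.
  rewrite [_ == x.2 :> nat]ltn_eqF -?yr // add0r c'E eqxx andbT /hasB.
  by rewrite (pos_max tmax) orbT mulr1 signr_eq0.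
case=> c'' k''; rewrite tcoef_cx mxE -/x => ne_t nz.
have wt_lead := lead_term_weight x2 lead.
case: (incidence_weight x2 nz) => [lt_wt|[t [tT y''T] [wt_eq cases]]].
  by apply: cell_key_lt; rewrite wt_lead.
suff : (tie_break c'' (enum_val k'').1 < tie_break c' (enum_val k).1)%N.
  by rewrite /key /cell_key /= wt_eq wt_lead ltn_add2l.
have same : c'' = c' -> (enum_val k'').1 = (enum_val k).1 ->
    (enum_val k'').2 = (enum_val k).2 :> nat -> False.
  move=> eqc eq1 eq2; case/eqP: ne_t; congr (_, _) => //; apply: enum_val_inj.
  by rewrite [LHS]surjective_pairing [RHS]surjective_pairing eq1; congr (_, _); apply: val_inj.
have /andP[nlow /implyP nhigh] := src.
case: lead => [[s [sT smin r2 [yT yr c'E]]]|[t0 [t0T t0max r1 [yT yr c'E]]]].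
  have low : has_low c' (enum_val k).1.
    apply/has_lowP; exists s; rewrite c'E lem_addl yT.
    split=> // u; rewrite !inE => /andP[us /smin].
    by rewrite leq_eqVlt => /predU1P[/val_inj su|//]; rewrite su eqxx in us.
  rewrite [X in (_ < X)%N]/tie_break low /=.
  suff nlow'' : ~~ has_low c'' (enum_val k'').1.
    by rewrite /tie_break (negPf nlow''); case: has_high.
  have [st|st] := eqVneq s t.
    case: cases => [[y''r _ c''E]|[_ pos_t _]].
      by case: same; rewrite ?c''E ?c'E ?st // ?y''T ?yT ?st // y''r yr.
    by move: pos_t; rewrite -st ltnNge (pos_min_ge sT smin (ltnW r2)).
  have lt_st : (s < t)%N.
    by rewrite ltn_neqAle smin // andbT; apply: contra st => /eqP/val_inj ->.
  rewrite y''T; case: cases => [[_ pos_t ->]|[_ pos_t ->]].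
    apply: (no_low_rem nlow sT st smin) => s' s's.
    (* Since [t] is in the a-part, some element of the set exceeds it; this is the third index that
       [cop_aa] asks for. *)
    have [|u _ tu] := @pos_gt0 _ x.1 t.
      by case/andP: x2 => x2_gt0 _; exact: leq_trans pos_t.
    exact: cop_aa (ltn_trans s's lt_st) tu.
  apply: (no_low_rem nlow sT st smin) => s' s's.
  exact: cop_ab (ltn_trans s's lt_st).
have {}nhigh := nhigh (introT eqP r1).
have high : has_high c' (enum_val k).1.
  apply/has_highP; exists t0; rewrite c'E lem_addl yT.
  split=> // u; rewrite !inE => /andP[ut /t0max].
  by rewrite leq_eqVlt => /predU1P[/val_inj ut0|//]; rewrite ut0 eqxx in ut.
apply: (@leq_trans 1); last by rewrite /tie_break high; case: has_low.
have [|s sT smin] := @ex_min x.1; first by rewrite -card_gt0 xT.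
have pos_s : (x.2 <= pos x.1 s)%N by apply: pos_min_ge => //; rewrite -r1.
(* Removing the only a-index is excluded by the bound on [y.2] in [cells]. *)
case: cases => [[y''r pos_t _]|[y''r pos_t c''E]].
  have := enum_valP k''; rewrite cellsS y''r => /and3P[_ _].
  by rewrite -ltnS r1 xT ltnS ltnn.
have [t0t|t0t] := eqVneq t0 t.
  by case: same; rewrite ?c''E ?c'E ?t0t // ?y''T ?yT ?t0t //; apply: succn_inj; rewrite y''r yr.
have st : s != t by apply: contraTneq pos_t => <-; rewrite -leqNgt.
have lt_st : (s < t)%N.
  by rewrite ltn_neqAle smin // andbT; apply: contra st => /eqP/val_inj ->.
rewrite /tie_break y''T c''E.
rewrite (negPf (no_low_rem nlow sT st smin _)) => [|s' s's]; last first.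
  exact: cop_ab (ltn_trans s's lt_st).
by rewrite (negPf (no_high_rem nhigh t0T t0t t0max lt_st tT)).
Qed.

Lemma ex_lead_term i c (j : 'I_#|cells N i.+2|) :
  exists c' (k : 'I_#|cells N i.+1|), lead_term c (enum_val j) c' (enum_val k).
Proof.
have := enum_valP j; set x := enum_val j; rewrite cellsS => /andP[/eqP xT /andP[r_gt0 r_le]].
have T_n0 : x.1 != set0 by rewrite -card_gt0 xT.
have [r2|] := ltnP x.2.+1 #|x.1|.
  have [s sT smin] := ex_min T_n0.
  have yF : (x.1 :\ s, x.2) \in cells N i.+1.
    have := xT; rewrite (cardsD1 s) sT add1n => -[Ts]; rewrite cellsS /= Ts eqxx r_gt0 /=.
    by move: r2; rewrite xT !ltnS.
  exists (c + a s)%MM, (enum_rank_in yF (x.1 :\ s, x.2)); left; exists s.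
  by rewrite enum_rankK_in.
rewrite xT => r1; have {r1}rE : x.2.+1 = #|x.1|.
  by apply/eqP; rewrite xT eqn_leq r1 !ltnS r_le.
have [t tT tmax] := ex_max T_n0.
have rN : (x.2.-1 < N.+1)%N by exact: leq_ltn_trans (leq_pred _) (ltn_ord x.2).
have yF : (x.1 :\ t, Ordinal rN) \in cells N i.+1.
  have := xT; rewrite (cardsD1 t) tT add1n => -[Ts]; rewrite cellsS /= Ts eqxx /=.
  by move: rE; rewrite xT => -[->] /=.
exists (c + b t)%MM, (enum_rank_in yF (x.1 :\ t, Ordinal rN)); right; exists t.
by rewrite enum_rankK_in //=; split=> //; split=> //; rewrite prednK.
Qed.

Lemma cell_eq x y : x.1 = y.1 -> x.2 = y.2 :> nat -> x = y.
Proof. by case: x y => [T r] [T' r'] /= -> /val_inj ->. Qed.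

Lemma setD1_inj T T' s : s \in T -> s \in T' -> T :\ s = T' :\ s -> T = T'.
Proof. by move=> sT sT' eqD; rewrite -(setD1K sT) -(setD1K sT') eqD. Qed.

Lemma source_low c x s : source c x -> (forall u, u \in x.1 -> (s < u)%N) ->
  ~ (a s <= c)%MM.
Proof. by case/andP=> /has_lowP nlow _ sT asc; apply: nlow; exists s. Qed.

Lemma source_high c x t : source c x -> x.2.+1 = #|x.1| ->
  (forall u, u \in x.1 -> (u < t)%N) -> ~ (b t <= c)%MM.
Proof.
case/andP=> _ /implyP nhigh /eqP/nhigh/has_highP{}nhigh tT btc.
by apply: nhigh; exists t.
Qed.

Lemma ex_above T s : (1 < #|T|)%N -> s \in T -> (forall u, u \in T -> (s <= u)%N) ->
  exists2 u, u \in T & (s < u)%N.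
Proof. by move=> T1 sT smin; apply: pos_gt0; apply: (pos_min_ge sT smin T1). Qed.

(** If two sources with the same partner had removed different entries, one of these entries would
    by coprimality divide the monomial of the other source and give it a low or high index. *)
Lemma lead_term_inj c x c' x' d y :
    source c x -> source c' x' -> (2 < #|x.1|)%N -> (2 < #|x'.1|)%N ->
    lead_term c x d y -> lead_term c' x' d y ->
  c = c' /\ x = x'.
Proof.
have lowlow c1 x1 c2 x2 s1 s2 (T3 : (2 < #|x2.1|)%N) : source c2 x2 ->
    s2 \in x2.1 -> (forall u, u \in x2.1 -> (s2 <= u)%N) ->
    (c1 + a s1)%MM = (c2 + a s2)%MM -> (s2 <= s1)%N.
  move=> src s2T s2min eqc; rewrite leqNgt; apply/negP => s12.
  have [u _ s2u] := ex_above (ltnW T3) s2T s2min.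
  apply: (source_low src) (_ : a s1 <= c2)%MM => [u' /s2min|]; first exact: leq_trans.
  by apply: coprime_mon_dvd (cop_aa s12 s2u) _; rewrite -eqc lem_addl.
(* The two kinds of removal never meet: the least index [m] of [x2.1] survives in the common set, so
   s < m < t, and a_s, coprime to b_t, divides [c2]. *)
have lowhigh c1 x1 c2 x2 s t : source c2 x2 -> s \in x1.1 -> t \in x2.1 ->
    (forall u, u \in x1.1 -> (s <= u)%N) -> (forall u, u \in x2.1 -> (u <= t)%N) ->
    (2 < #|x2.1|)%N ->
    x1.1 :\ s = x2.1 :\ t -> (c1 + a s)%MM = (c2 + b t)%MM -> False.
  move=> src sT tT smin tmax T3 eqT eqc.
  have [|m mT mmin] := @ex_min x2.1; first by rewrite -card_gt0 (leq_trans _ T3).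
  have [u uT mu] := ex_above (ltnW T3) mT mmin.
  have mt : (m < t)%N by exact: leq_trans (tmax _ uT).
  have : m \in x1.1 :\ s by rewrite eqT !inE mT neq_ltn mt.
  rewrite !inE => /andP[ms /smin]; rewrite leq_eqVlt => /predU1P[/val_inj sm|sm].
    by rewrite sm eqxx in ms.
  apply: (source_low src) (_ : a s <= c2)%MM => [u' /mmin|]; first exact: leq_trans.
  by apply: coprime_mon_dvd (cop_ab (ltn_trans sm mt)) _; rewrite -eqc lem_addl.
have highhigh c1 x1 c2 x2 t1 t2 (T3 : (2 < #|x1.1|)%N) : source c2 x2 ->
    t1 \in x1.1 -> t2 \in x2.1 -> x2.2.+1 = #|x2.1| ->
    (forall u, u \in x1.1 -> (u <= t1)%N) -> (forall u, u \in x2.1 -> (u <= t2)%N) ->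
    (2 < #|x2.1|)%N ->
    (c1 + b t1)%MM = (c2 + b t2)%MM -> (t1 <= t2)%N.
  move=> src t1T t2T r2 t1max t2max T3' eqc; rewrite leqNgt; apply/negP => t21.
  have [|m mT mmin] := @ex_min x2.1; first by rewrite -card_gt0 (leq_trans _ T3').
  have [u uT mu] := ex_above (ltnW T3') mT mmin.
  have mt : (m < t2)%N by exact: leq_trans (t2max _ uT).
  apply: (source_high src r2) (_ : b t1 <= c2)%MM => [u' /t2max ut2|].
    exact: leq_ltn_trans t21.
  apply: coprime_mon_dvd (coprime_mon_sym (cop_bb mt t21)) _.
  by rewrite -eqc lem_addl.
move=> src src' T3 T3'.
case=> [[s [sT smin r2 [yT yr dE]]]|[t [tT tmax r1 [yT yr dE]]]];
case=> [[s' [s'T s'min r2' [yT' yr' dE']]]|[t' [t'T t'max r1' [yT' yr' dE']]]].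
- have eqc : (c + a s)%MM = (c' + a s')%MM by rewrite -dE.
  have eqs : s = s'.
    apply/val_inj/eqP; rewrite eqn_leq.
    rewrite (lowlow _ _ _ _ _ _ T3 src sT smin (esym eqc)) //.
    by rewrite (lowlow _ _ _ _ _ _ T3' src' s'T s'min eqc).
  subst s'; split; first exact: addIm eqc.
  by apply: cell_eq; [apply: setD1_inj sT s'T _; rewrite -yT | rewrite -yr].
- by case: (lowhigh c x c' x' s t') => //; [rewrite -yT | rewrite -dE].
- by case: (lowhigh c' x' c x s' t) => //; [rewrite -yT' | rewrite -dE'].
have eqc : (c + b t)%MM = (c' + b t')%MM by rewrite -dE.
have eqt : t = t'.
  apply/val_inj/eqP; rewrite eqn_leq.
  rewrite (highhigh c x c' x') // (highhigh c' x' c x) //.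
subst t'; split; first exact: addIm eqc.
by apply: cell_eq; [apply: setD1_inj tT t'T _; rewrite -yT | rewrite -yr].
Qed.

Lemma has_low_min c T : has_low c T ->
  exists s, [/\ forall u, u \in T -> (s < u)%N, (a s <= c)%MM &
    forall s' : 'I_N, (s' < s)%N -> ~ (a s' <= c)%MM].
Proof.
case/has_lowP=> s0 [s0T as0c].
have P0 : (s0 <= s0)%N && (a s0 <= c)%MM by rewrite leqnn.
case: (arg_minnP (P := fun s : 'I_N => (s <= s0)%N && (a s <= c)%MM)
  (fun s : 'I_N => s : nat) P0) => s /andP[ss0 asc] smin.
exists s; split=> // [u /s0T|s' s's as'c]; first exact: leq_ltn_trans.
have := smin s'; rewrite as'c (ltnW (leq_trans s's ss0)) => /(_ isT) /=.
by rewrite leqNgt s's.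
Qed.

Lemma has_high_max c T : has_high c T ->
  exists t, [/\ forall u, u \in T -> (u < t)%N, (b t <= c)%MM &
    forall t' : 'I_N, (t < t')%N -> ~ (b t' <= c)%MM].
Proof.
case/has_highP=> t0 [t0T bt0c].
have P0 : (t0 <= t0)%N && (b t0 <= c)%MM by rewrite leqnn.
case: (arg_maxnP (P := fun t : 'I_N => (t0 <= t)%N && (b t <= c)%MM)
  (fun s : 'I_N => s : nat) P0) => t /andP[tt0 btc] tmax.
exists t; split=> // [u /t0T ut0|t' t't bt'c]; first exact: leq_trans tt0.
have := tmax t'; rewrite bt'c (ltnW (leq_ltn_trans tt0 t't)) => /(_ isT) /=.
by rewrite leqNgt t't.
Qed.

(** A term that is not a source gains the least low index or, failing that, the greatest high one;
    this extremal choice makes the enlarged term a source. *)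
Lemma source_or_lead i c' (k : 'I_#|cells N i.+1|) :
  source c' (enum_val k) \/
  exists c (j : 'I_#|cells N i.+2|),
    source c (enum_val j) /\ lead_term c (enum_val j) c' (enum_val k).
Proof.
have := enum_valP k; set y := enum_val k; rewrite cellsS => /andP[/eqP yT /andP[r_gt0 r_le]].
have [low|nlow] := boolP (has_low c' y.1).
  right; have [s [sT asc smin]] := has_low_min low.
  have sNT : s \notin y.1 by apply/negP => /sT; rewrite ltnn.
  have T's : #|s |: y.1| = i.+3 by rewrite cardsU1 sNT yT.
  have xF : (s |: y.1, y.2) \in cells N i.+2.
    by rewrite cellsS /= T's eqxx r_gt0 /=; exact: leqW.
  exists (c' - a s)%MM, (enum_rank_in xF (s |: y.1, y.2)); rewrite enum_rankK_in //.
  split; last first.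
    left; exists s; rewrite /= setU1K // setU11 T's !ltnS submK //.
    by split=> // u; rewrite in_setU1 => /predU1P[->//|/sT/ltnW].
  apply/andP; split; last by rewrite /= T's !eqSS ltn_eqF.
  apply/has_lowP => -[s' [s'T as'c]]; apply: (smin s'); first by apply: s'T; rewrite setU11.
  exact: lepm_trans as'c (lem_subr _ _).
have [high|nhigh] := boolP ((y.2.+1 == #|y.1|) && has_high c' y.1); last first.
  by left; rewrite /source nlow implybE -negb_and.
right; have {high}[/eqP rE /has_high_max[t [tT btc tmax]]] := andP high.
have tNT : t \notin y.1 by apply/negP => /tT; rewrite ltnn.
have T't : #|t |: y.1| = i.+3 by rewrite cardsU1 tNT yT.
have rN : (y.2.+1 < N.+1)%N.
  by rewrite rE ltnS; apply: leq_trans (max_card _) _; rewrite card_ord.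
have xF : (t |: y.1, Ordinal rN) \in cells N i.+2.
  by rewrite cellsS /= T't eqxx /= ltnS.
exists (c' - b t)%MM, (enum_rank_in xF (t |: y.1, Ordinal rN)); rewrite enum_rankK_in //.
split; last first.
  right; exists t; rewrite /= setU1K // setU11 T't rE yT submK //.
  by split=> // u; rewrite in_setU1 => /predU1P[->//|/tT/ltnW].
apply/andP; split.
  apply: contra nlow => /has_lowP[s' [s'T as'c]]; apply/has_lowP; exists s'.
  split=> [u uT|]; first by apply: s'T; rewrite in_setU1 uT orbT.
  exact: lepm_trans as'c (lem_subr _ _).
apply/implyP => _; apply/has_highP => -[t' [t'T bt'c]]; apply: (tmax t').
  by apply: t'T; rewrite setU11.
exact: lepm_trans bt'c (lem_subr _ _).
Qed.

Definition pair_lead c x c' (y : cell) : Prop :=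
  exists s t, [/\ (s < t)%N, x.1 = [set s; t] & c' = (c + (a s + b t))%MM].

Lemma cells1P x : x \in cells N 1 -> exists s t, (s < t)%N /\ x.1 = [set s; t].
Proof.
rewrite cellsS => /andP[/cards2P[s [t [st xT]]] _].
have [lt_st|lt_ts|/val_inj eq_st] := ltngtP s t; last by rewrite eq_st eqxx in st.
  by exists s, t.
by exists t, s; rewrite setUC.
Qed.

Lemma leads_pair c (j : 'I_#|cells N 1|) c' (k : 'I_#|cells N 0|) :
  pair_lead c (enum_val j) c' (enum_val k) -> leads (cx_d 0) (@key 0) (c, j) (c', k).
Proof.
case=> s [t [st xT ->]].
have coefE c'' k'' : tcoef (termv (c, j) *m cx_d 0) (c'', k'') =
    ((c + (a s + b t))%MM == c'')%:R - (eps && ((c + (a t + b s))%MM == c''))%:R.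
  rewrite tcoef_cx mxE xT minor_pair // mulrBr mcoeffB -mpolyXD mcoeffX; congr (_ - _).
  by case: (eps); rewrite ?mul1r ?mul0r ?mulr0 ?mcoeff0 // -mpolyXD mcoeffX.
have wt_lt : (wt (c + (a t + b s)) < wt (c + (a s + b t)))%N.
  by rewrite !wtD !wt_a !wt_b !ltn_add2l.
split=> [|[c'' k''] ne_t]; rewrite coefE.
  have /negPf -> : (c + (a t + b s))%MM != (c + (a s + b t))%MM.
    by apply: contraTneq wt_lt => ->; rewrite ltnn.
  by rewrite eqxx andbF subr0 oner_eq0.
have kk : k'' = k.
  apply: enum_val_inj; have := enum_valP k; have := enum_valP k''.
  by rewrite !cells0 => /eqP -> /eqP ->.
rewrite kk xpair_eqE eqxx andbT eq_sym in ne_t; rewrite (negPf ne_t) sub0r oppr_eq0 kk.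
have [<- _|_] := eqVneq (c + (a t + b s))%MM c''; last by rewrite andbF eqxx.
by apply: cell_key_lt; rewrite ltn_add2r.
Qed.

(** A cell over a pair has r = 1, so a source there has neither a low nor a high index. Comparing
    two presentations in both directions forces equal pairs. *)
Lemma pair_lead_inj c x c' x' d y :
    x \in cells N 1 -> x' \in cells N 1 -> source c x -> source c' x' ->
    pair_lead c x d y -> pair_lead c' x' d y ->
  c = c' /\ x = x'.
Proof.
have half c1 x1 c2 x2 : x1 \in cells N 1 -> x2 \in cells N 1 -> source c2 x2 ->
    pair_lead c1 x1 d y -> pair_lead c2 x2 d y -> forall s1 t1 s2 t2,
    (s1 < t1)%N -> x1.1 = [set s1; t1] -> (s2 < t2)%N -> x2.1 = [set s2; t2] ->
    (c1 + (a s1 + b t1))%MM = (c2 + (a s2 + b t2))%MM -> (s2 <= s1)%N && (t1 <= t2)%N.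
  move=> x1F x2F src _ _ s1 t1 s2 t2 st1 x1T st2 x2T eqc.
  apply/andP; split; rewrite leqNgt; apply/negP => lt.
    apply: (source_low src) (_ : a s1 <= c2)%MM => [u|].
      by rewrite x2T !inE => /orP[] /eqP ->; lia.
    apply: coprime_mon_dvd (cop_aa lt st2) _.
    apply: coprime_mon_dvd (cop_ab (ltn_trans lt st2)) _.
    by rewrite -addmA -eqc addmA (addmC c1) -addmA lem_addr.
  apply: (source_high src) (_ : b t1 <= c2)%MM => [|u|].
  - by move: x2F; rewrite cellsS => /andP[/eqP -> /andP[]]; case: (nat_of_ord _) => [|[]].
  - by rewrite x2T !inE => /orP[] /eqP ->; lia.
  apply: coprime_mon_dvd (coprime_mon_sym (cop_ab (ltn_trans st2 lt))) _.
  apply: coprime_mon_dvd (coprime_mon_sym (cop_bb st2 lt)) _.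
  by rewrite -addmA -eqc addmA lem_addl.
move=> xF x'F src src' lead lead'; have [s [t [st xT dE]]] := lead.
have [s' [t' [st' xT' dE']]] := lead'.
have eqc : (c + (a s + b t))%MM = (c' + (a s' + b t'))%MM by rewrite -dE.
have /andP[ss tt] := half _ _ _ _ xF x'F src' lead lead' _ _ _ _ st xT st' xT' eqc.
have /andP[ss' tt'] := half _ _ _ _ x'F xF src lead' lead _ _ _ _ st' xT' st xT (esym eqc).
have eqs : s = s' by apply/val_inj/eqP; rewrite eqn_leq ss ss'.
have eqt : t = t' by apply/val_inj/eqP; rewrite eqn_leq tt tt'.
subst s' t'; split; first exact: addIm eqc.
apply: cell_eq; first by rewrite xT.
by move: xF x'F; rewrite !cellsS => /andP[_ r1] /andP[_ r1']; lia.
Qed.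

Lemma cx_exact i (v : 'rV_#|cells N i.+1|) :
  v *m cx_d i = 0 <-> exists w, v = w *m cx_d i.+1.
Proof.
have cover (f : 'X_{1..n} * 'I_#|cells N i.+1|) :
    source f.1 (enum_val f.2) \/ exists e, leads (cx_d i.+1) (@key i.+1) e f.
  case: f => c' k /=; case: (source_or_lead c' k) => [|[c [j [src lead]]]]; first by left.
  by right; exists (c, j); exact: leads_lead_term.
move: v cover; case: i => [|i] v cover.
  apply: (exact_of_leads (key := @key 0)
    (ld := fun e f => pair_lead e.1 (enum_val e.2) f.1 (enum_val f.2)) (cx_dd _ _ _ _ _) cover).
  - case=> c j /= _; have [s [t [st xT]]] := cells1P (enum_valP j).
    have c0 : (set0, ord0) \in cells N 0 by rewrite cells0.
    by exists (c + (a s + b t), enum_rank_in c0 (set0, ord0))%MM; exists s, t.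
  - by case=> c j [c' k] /= _; exact: leads_pair.
  case=> c j [c' j'] [d k] /= src src' lead lead'.
  have [-> /enum_val_inj -> //] := pair_lead_inj (enum_valP j) (enum_valP j') src src' lead lead'.
apply: (exact_of_leads (key := @key i.+1)
  (ld := fun e f => lead_term e.1 (enum_val e.2) f.1 (enum_val f.2)) (cx_dd _ _ _ _ _) cover).
- case=> c j /= _; have [c' [k lead]] := ex_lead_term c j.
  by exists (c', k).
- by case=> c j [c' k] /=; exact: leads_lead_term.
case=> c j [c' j'] [d k] /= src src' lead lead'.
have card3 (l : 'I_#|cells N i.+2|) : (2 < #|(enum_val l).1|)%N.
  by have := enum_valP l; rewrite cellsS => /andP[/eqP ->].
by have [-> /enum_val_inj ->] := lead_term_inj src src' (card3 j) (card3 j') lead lead'.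
Qed.

(** * Augmentation and minimality *)

Section Resolution.
Variables (M : lmodType S) (m0 : M).
Hypothesis a_neq0 : forall s, a s != 0%MM.
Hypothesis b_neq0 : forall s, b s != 0%MM.
Hypothesis m0_gen : forall m, exists p : S, p *: m0 = m.
Hypothesis minor_m0 : forall s t, (s < t)%N ->
  ('X_[a s + b t] - eps%:R * 'X_[a t + b s] : S) *: m0 = 0.
(** Linear independence over [K], in [M], of the monomials divisible by no diagonal product. *)
Hypothesis normal_m0 : forall p : S, p *: m0 = 0 ->
  (forall c s t, c \in msupp p -> (s < t)%N -> ~~ (a s + b t <= c)%MM) -> p = 0.

Lemma cell0_in : (set0, ord0) \in cells N 0. Proof. by rewrite cells0. Qed.

Definition cell0 : 'I_#|cells N 0| := enum_rank_in cell0_in (set0, ord0).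

Lemma cell0E k : k = cell0.
Proof.
apply: enum_val_inj; rewrite enum_rankK_in ?cell0_in //.
by have := enum_valP k; rewrite cells0 => /eqP.
Qed.

Definition cx_aug (v : 'rV[S]_#|cells N 0|) : M := v 0 cell0 *: m0.

Lemma cx_aug_is_linear : linear cx_aug.
Proof. by move=> p v v'; rewrite /cx_aug !mxE scalerDl scalerA. Qed.

HB.instance Definition _ := GRing.isLinear.Build S 'rV[S]_#|cells N 0| M *:%R cx_aug
  cx_aug_is_linear.

Lemma cx_aug_surj m : exists v, cx_aug v = m.
Proof.
by have [p <-] := m0_gen m; exists (const_mx p); rewrite /cx_aug mxE.
Qed.

Lemma cx_aug_boundary (w : 'rV_#|cells N 1|) : cx_aug (w *m cx_d 0) = 0.
Proof.
rewrite /cx_aug mxE scaler_suml big1 // => j _; rewrite -scalerA mxE.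
have [s [t [st ->]]] := cells1P (enum_valP j).
by rewrite minor_pair // minor_m0 ?scaler0.
Qed.

Lemma cx_exact0 (v : 'rV_#|cells N 0|) :
  cx_aug v = 0 <-> exists w, v = w *m cx_d 0.
Proof.
split=> [v0|[w ->]]; last exact: cx_aug_boundary.
pose normal (f : 'X_{1..n} * 'I_#|cells N 0|) :=
  forall s t, (s < t)%N -> ~~ (a s + b t <= f.1)%MM.
have [f|w wP] := @reduce_terms _ _ _ _ (cx_d 0) (@key 0) normal _ v.
  have [/existsP[s /existsP[t /andP[st stf]]]|none] :=
    boolP [exists s : 'I_N, exists t : 'I_N, (s < t)%N && (a s + b t <= f.1)%MM].
    right; have N1 : (1 < N.+1)%N by have := ltn_ord t; lia.
    have xF : ([set s; t], Ordinal N1) \in cells N 1.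
      by rewrite cellsS /= cards2 neq_ltn st.
    exists ((f.1 - (a s + b t))%MM, enum_rank_in xF ([set s; t], Ordinal N1)).
    case: f stf => c k /= stc; apply: leads_pair; exists s, t.
    by rewrite enum_rankK_in //= submK.
  left=> s t st; apply: contra none => stf.
  by apply/existsP; exists s; apply/existsP; exists t; rewrite st.
exists w; apply/eqP; rewrite -subr_eq0; apply/eqP/rowP => k.
rewrite [k]cell0E [RHS]mxE; apply: normal_m0 => [|c s t cP st].
  by rewrite -[LHS]/(cx_aug _) linearB /= v0 cx_aug_boundary subr0.
by apply: (wP (c, cell0)) st; rewrite /tcoef -mcoeff_msupp.
Qed.

Definition cx_resolution : free_resolution M :=
  FreeResolution cx_aug_surj cx_exact0 cx_exact.

Lemma cx_minimal i : res_dK cx_resolution i = 0.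
Proof.
have coef0 (m : 'X_{1..n}) : m != 0%MM -> ('X_[m] : S)@_0%MM = 0.
  by move=> m_n0; rewrite mcoeffX (negPf m_n0).
apply/matrixP => j k; rewrite /res_dK /= !mxE.
case: i j k => [|i] j k.
  have [s [t [st ->]]] := cells1P (enum_valP j).
  rewrite minor_pair // mcoeffB rmorphM /= !coef0 ?mulr0 ?subr0 //.
    by rewrite mnmD_eq0 negb_and a_neq0.
  by rewrite mnmD_eq0 negb_and a_neq0.
rewrite raddf_sum big1 //= => t _.
by rewrite /face !(rmorphM, rmorphD) /= !coef0 ?a_neq0 ?b_neq0 // !mulr0 addr0 mulr0.
Qed.

Lemma betti_cx i : betti M i = #|cells N i|.
Proof. by rewrite (betti_minimal _ cx_minimal). Qed.

End Resolution.
End Exactness.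

(** * Two-ear graphs *)

Lemma ideal_mons_support (K : fieldType) n (A : 'X_{1..n} -> Prop) (p : {mpoly K[n]}) c :
  p \in ideal (mons A) -> c \in msupp p -> exists2 d, A d & (d <= c)%MM.
Proof.
move=> /asboolP; elim=> [|q _ r [d Ad ->] _ IH]; first by rewrite msupp0.
rewrite mcoeff_msupp mcoeffD.
have [->|rc _] := eqVneq r@_c 0; last by apply: IH; rewrite mcoeff_msupp.
rewrite addr0 -mcoeff_msupp (perm_mem (msuppMX q d)) => /mapP[e _ ->].
by exists d; rewrite ?lem_addr.
Qed.

Lemma ex_leading_mon (K : fieldType) n (le : rel 'X_{1..n}) (p : {mpoly K[n]}) :
  monomial_order le -> p != 0 -> exists c, is_leading_mon le p c.
Proof.
move=> hle; rewrite -msupp_eq0 /is_leading_mon; elim: (msupp p) => // c s IH _.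
have lecc : le c c by have := mo_total hle c c; rewrite orbb.
have [->|/IH[d [ds dmax]]] := eqVneq s [::].
  by exists c; split=> [|d]; rewrite inE // => /eqP ->.
have /orP[cd|dc] := mo_total hle c d.
  exists d; split=> [|e]; rewrite inE ?ds ?orbT // => /predU1P[->//|]; exact: dmax.
exists c; split=> [|e]; rewrite inE ?eqxx // => /predU1P[->//|/dmax ed].
exact: mo_trans hle _ _ _ ed dc.
Qed.

Lemma coprime_monD n (c d m : 'X_{1..n}) :
  coprime_mon c m -> coprime_mon d m -> coprime_mon (c + d)%MM m.
Proof.
move=> cm dm j; rewrite mnmDE; case: (cm j) => [->|]; last by right.
by case: (dm j) => [->|]; [left | right].
Qed.

Section TwoEar.
Variables (K : fieldType) (m : nat) (G : sgraph) (phi : te_labeling m G).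

Local Notation N := m.-1.+2.
Local Notation mon := 'X_{1..#|edge G|}.
Local Notation te_var := (te_var phi).
Local Notation te_edge := (te_edge phi).
Implicit Types (s t : 'I_N) (l : te_label m).

(** [insub] fails only for the last column, of index [m.-1.+1]. *)
Definition top_entry s : mon :=
  match (s : nat) with
  | 0 => te_var f1 + te_var g2
  | s'.+1 => if (insub s' : option 'I_m.-1) is Some j then te_var (e1 j)
             else te_var w + te_var f3
  end%MM.

Definition bottom_entry s : mon :=
  match (s : nat) with
  | 0 => te_var w + te_var g3
  | s'.+1 => if (insub s' : option 'I_m.-1) is Some j then te_var (e2 j)
             else te_var f2 + te_var g1
  end%MM.

Variant column_spec s : mon -> mon -> Prop :=
| FirstColumn of s = 0%N :> nat :
    column_spec s (te_var f1 + te_var g2)%MM (te_var w + te_var g3)%MM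
| MiddleColumn (j : 'I_m.-1) of s = j.+1 :> nat :
    column_spec s (te_var (e1 j)) (te_var (e2 j))
| LastColumn of s = m.-1.+1 :> nat :
    column_spec s (te_var w + te_var f3)%MM (te_var f2 + te_var g1)%MM.

Lemma columnP s : column_spec s (top_entry s) (bottom_entry s).
Proof.
rewrite /top_entry /bottom_entry; case sE: (s : nat) => [|s']; first by constructor.
case: insubP => [j _ jE|]; first by constructor; rewrite sE jE.
rewrite -leqNgt => s'm; constructor.
by apply/eqP; rewrite sE eqSS eqn_leq s'm andbT -ltnS -ltnS -sE.
Qed.

Lemma te_edge_inj : injective te_edge.
Proof.
have phi_inj : injective phi by exact/bij_inj/te_bij.
move=> l l' /(congr1 val) /= /setP eq_ends.
have in_ends a : a = (te_ends l).1 \/ a = (te_ends l).2 ->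
    a = (te_ends l').1 \/ a = (te_ends l').2.
  have := eq_ends (phi a); rewrite !inE.
  by case=> eq_in [] /(congr1 phi)/eqP aE; move: eq_in; rewrite aE ?orbT => /esym/orP[]
    /eqP/phi_inj; auto.
have := in_ends _ (or_introl erefl); have := in_ends _ (or_intror erefl).
by case: {eq_ends in_ends} l => [i|i|||||||]; case: l' => [j|j|||||||] /=;
  do 2![case=> ?]; congruence.
Qed.

Lemma te_var_coprime l l' : l <> l' -> coprime_mon (te_var l) (te_var l').
Proof.
move=> ne_l j; rewrite !mnm1E; case: eqP => [<-|]; last by left.
by right; case: eqP => // /enum_rank_inj/te_edge_inj/esym.
Qed.

Local Ltac coprime_vars :=
  repeat first [apply: te_var_coprime; congruence | apply: coprime_monD
               | apply: coprime_mon_sym; apply: coprime_monD].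

Lemma top_coprime s t (v : 'I_N) : (s < t)%N -> (t < v)%N ->
  coprime_mon (top_entry s) (top_entry t).
Proof.
have vN := ltn_ord v.
case: columnP => [sE|i sE|sE]; case: columnP => [tE|j tE|tE] st tv; try lia.
  coprime_vars.
by apply: te_var_coprime => -[ij]; rewrite sE tE ij ltnn in st.
Qed.

Lemma top_bottom_coprime s t : (s < t)%N -> coprime_mon (top_entry s) (bottom_entry t).
Proof.
have tN := ltn_ord t.
case: columnP => [sE|i sE|sE]; case: columnP => [tE|j tE|tE] st; try lia.
all: coprime_vars.
Qed.

Lemma bottom_coprime (v s t : 'I_N) : (v < s)%N -> (s < t)%N ->
  coprime_mon (bottom_entry s) (bottom_entry t).
Proof.
have tN := ltn_ord t.
case: columnP => [sE|i sE|sE]; case: columnP => [tE|j tE|tE] vs st; try lia.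
  by apply: te_var_coprime => -[ij]; rewrite sE tE ij ltnn in st.
coprime_vars.
Qed.

(** Among the entries, [f2] occurs only in the last bottom one, so it can carry the whole weight of
    that entry. *)
Definition te_weight (c : mon) : nat :=
  (\sum_(j < m.-1) j.+1 * c (enum_rank (te_edge (e2 j)))
   + m.-1.+1 * c (enum_rank (te_edge f2)))%N.

Lemma te_weightD c d : te_weight (c + d)%MM = (te_weight c + te_weight d)%N.
Proof.
rewrite /te_weight mnmDE mulnDr addnACA -big_split /=; congr (_ + _)%N.
by apply: eq_bigr => j _; rewrite mnmDE mulnDr.
Qed.

Lemma te_varE l l' : te_var l (enum_rank (te_edge l')) = `[< l = l' >].
Proof.
rewrite mnm1E (inj_eq enum_rank_inj); congr nat_of_bool; apply/eqP/asboolP => [|->//].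
exact: te_edge_inj.
Qed.

Lemma te_weight_var l : te_weight (te_var l) =
  match l with e2 j => j.+1 | f2 => m.-1.+1 | _ => 0 end%N.
Proof.
have sum0 : (forall j, l <> e2 j) ->
    (\sum_(j < m.-1) j.+1 * te_var l (enum_rank (te_edge (e2 j))) = 0)%N.
  by move=> ne; rewrite big1 // => j _; rewrite te_varE asboolF ?muln0.
rewrite /te_weight te_varE; case: l sum0 => [i|i|||||||] sum0.
2: { rewrite asboolF // muln0 addn0 (bigD1 i) //= te_varE asboolT // muln1.
     rewrite big1 ?addn0 // => j ne_ji; rewrite te_varE asboolF ?muln0 //.
     by case=> ij; rewrite ij eqxx in ne_ji. }
all: rewrite sum0 //.
3: by rewrite asboolT // muln1.
all: by rewrite asboolF ?muln0.
Qed.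

Lemma te_weight_top s : te_weight (top_entry s) = 0%N.
Proof. by case: columnP => *; rewrite ?te_weightD !te_weight_var. Qed.

Lemma te_weight_bottom s : te_weight (bottom_entry s) = s.
Proof. by case: columnP => [->|j ->|->]; rewrite ?te_weightD !te_weight_var ?addn0. Qed.

Lemma te_var_neq0 l c : (te_var l + c)%MM != 0%MM.
Proof. by rewrite mnmD_eq0 mnm1_eq0. Qed.

Lemma top_entry_neq0 s : top_entry s != 0%MM.
Proof. by case: columnP => *; rewrite ?te_var_neq0 // mnm1_eq0. Qed.

Lemma bottom_entry_neq0 s : bottom_entry s != 0%MM.
Proof. by case: columnP => *; rewrite ?te_var_neq0 // mnm1_eq0. Qed.

Lemma te_MP (c : mon) :
  te_M phi c <-> exists s t : 'I_N, (s < t)%N /\ c = (top_entry s + bottom_entry t)%MM.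
Proof.
have middle (j : 'I_m.-1) : exists2 s : 'I_N, s = j.+1 :> nat &
    top_entry s = te_var (e1 j) /\ bottom_entry s = te_var (e2 j).
  have jN : (j.+1 < N)%N by rewrite ltnS leqW.
  exists (Ordinal jN) => //; case: columnP => /= [//|i [/val_inj->]//|[jE]].
  by have := ltn_ord j; rewrite jE ltnn.
have [first [fst_top fst0]] :
    exists s : 'I_N, top_entry s = (te_var f1 + te_var g2)%MM /\ s = 0%N :> nat.
  by exists ord0; split=> //; case: columnP.
have [last [last_bot lastE]] :
    exists s : 'I_N, bottom_entry s = (te_var f2 + te_var g1)%MM /\ s = m.-1.+1 :> nat.
  exists ord_max; split=> //; case: columnP => /= [//|j [jE]|//].
  by have := ltn_ord j; rewrite -jE ltnn.
split; last first.
  case=> s [t [st ->]]; have tN := ltn_ord t.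
  case: (columnP s) => [sE|i sE|sE]; case: (columnP t) => [tE|j tE|tE]; try lia.
  - by apply: Or44; exists j; rewrite (addmC (te_var f1)).
  - apply: Or42; rewrite /te_M2 -!addmA; congr (_ + _)%MM.
    by rewrite addmC -addmA.
  - by apply: Or41; exists i, j; split=> //; rewrite sE tE in st.
  by apply: Or43; exists i; rewrite addmC (addmC (te_var f2)).
case=> [[i [j [ij ->]]]|->|[i ->]|[i ->]].
- have [s sE [<- _]] := middle i; have [t tE [_ <-]] := middle j.
  by exists s, t; rewrite sE tE.
- exists first, last; rewrite fst0 lastE fst_top last_bot; split=> //.
  by rewrite -!addmA; congr (_ + _)%MM; rewrite [RHS]addmC -!addmA.
- have [s sE [<- _]] := middle i; exists s, last; rewrite sE lastE ltnS ltn_ord.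
  by rewrite last_bot addmC (addmC (te_var g1)).
have [t tE [_ <-]] := middle i; exists first, t; rewrite fst0 tE.
by rewrite fst_top (addmC (te_var f1)).
Qed.

Local Notation tmap := (@toric_map K G).
Local Notation V x := ('X_(enum_rank (phi x)) : {mpoly K[#|G|]}).

Lemma toric_var l : tmap 'X_[te_var l] = V (te_ends l).1 * V (te_ends l).2.
Proof.
rewrite /toric_map comp_mpolyXU -tnth_nth tnth_mktuple enum_rankK /edge_mon /=.
rewrite big_setU1 ?big_set1 // inE; apply/eqP => eq_ends.
have : adj (phi (te_ends l).1) (phi (te_ends l).2).
  by apply/te_adjP; exists l; left; case: (te_ends l).
by rewrite eq_ends adj_irr.
Qed.

Lemma toric_mapM p q : tmap (p * q) = tmap p * tmap q :> {mpoly K[#|G|]}.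
Proof. exact: rmorphM. Qed.

(** The image of the matrix has proportional rows, so its 2-minors vanish. *)
Lemma toric_column s : exists U,
  tmap 'X_[top_entry s] = V v1 * U /\ tmap 'X_[bottom_entry s] = V v2 * U.
Proof.
case: columnP => [_|j _|_]; rewrite ?mpolyXD ?toric_mapM !toric_var /=.
- by exists (V x1 * V y1 * V y2); split; ring.
- by exists (V (u j)).
by exists (V x1 * V x2 * V y1); split; ring.
Qed.

Lemma toric_minor s t :
  tmap ('X_[top_entry s + bottom_entry t] - 'X_[top_entry t + bottom_entry s]) = 0.
Proof.
rewrite !mpolyXD /toric_map rmorphB /= -!/(tmap _) !toric_mapM.
have [U [-> ->]] := toric_column s; have [W [-> ->]] := toric_column t.
by ring.
Qed.

Lemma toric_map_onto (x : {mpoly K[#|G|]}) : x \in @edge_subalg K G ->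
  exists p, tmap p = x.
Proof.
move=> /asboolP; elim=> [_ [e ->]|c|y z _ [p <-] _ [q <-]|y z _ [p <-] _ [q <-]].
- exists 'X_(enum_rank e).
  by rewrite /toric_map comp_mpolyXU -tnth_nth tnth_mktuple enum_rankK.
- by exists c%:MP; rewrite /toric_map comp_mpolyC alg_mpolyC.
- by exists (p + q); rewrite /toric_map rmorphD.
by exists (p * q); rewrite toric_mapM.
Qed.

(** * Betti numbers of the two modules *)

Section InitialIdeal.
Variable le : rel mon.
Hypothesis hle : monomial_order le.
Hypothesis hin : minimal_mon_gens (initial_ideal le (toric_ideal K G)) (te_M phi).

Lemma betti_edge_ring i : betti (edge_ring K G) i = #|cells N i|.
Proof.
have unitE p : val (p *: (1 : edge_ring K G)) = tmap p by exact: mulr1.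
apply: (@betti_cx K _ _ top_entry bottom_entry true te_weight te_weightD te_weight_top
  te_weight_bottom top_coprime top_bottom_coprime bottom_coprime (edge_ring K G) 1).
- exact: top_entry_neq0.
- exact: bottom_entry_neq0.
- move=> x; have [p px] := toric_map_onto (valP x).
  by exists p; apply: val_inj; rewrite unitE.
- by move=> s t _; apply: val_inj; rewrite unitE mul1r toric_minor.
move=> p /(congr1 val); rewrite unitE => p0 normal.
apply/eqP; apply/negPn/negP => /(ex_leading_mon hle)[c cP].
(* The leading monomial of a nonzero element of the toric ideal is a multiple of some diagonal
   product, against normality. *)
have : ('X_[c] : {mpoly K[#|edge G|]}) \in ideal (mons (te_M phi)).
  have <- := hin.1 'X_[c]; apply/asboolP; rewrite -[X in ideal_gen _ X]addr0 -[X in X + _]mul1r.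
  apply: ideal_genMD; last exact: ideal_gen0.
  by exists p, c; split=> //; apply/eqP.
move=> /ideal_mons_support cJ; have [|_ /te_MP[s [t [st ->]]]] := cJ c.
  by rewrite msuppX inE.
by apply/negP; apply: normal st; case: cP.
Qed.

Lemma betti_initial i : betti (quot_mod (leading_mons le (toric_ideal K G))) i = #|cells N i|.
Proof.
set P := leading_mons _ _; pose one := quot_proj P 1.
have scale_one p : p *: one = quot_proj P p.
  by rewrite /one -[LHS]/(quot_scale _ _) quot_scaleE mulr1.
have proj0 p : p \in ideal P -> quot_proj P p = 0.
  move=> Pp; have <- : quot_proj P 0 = 0.
    by apply: (@addrI _ (quot_proj P 0)); rewrite -quot_projD !addr0.
  by apply/quot_projE; rewrite subr0.
apply: (@betti_cx K _ _ top_entry bottom_entry false te_weight te_weightD te_weight_top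
  te_weight_bottom top_coprime top_bottom_coprime bottom_coprime _ one).
- exact: top_entry_neq0.
- exact: bottom_entry_neq0.
- by move=> x; exists (repr (x : @Quotient.quot _ (ideal P))); rewrite scale_one quot_projK.
- move=> s t st; rewrite mul0r subr0 scale_one proj0 // (hin.1 'X_[_]).
  apply/asboolP; rewrite -[X in ideal_gen _ X]addr0 -[X in X + _]mul1r.
  apply: ideal_genMD; last exact: ideal_gen0.
  by exists (top_entry s + bottom_entry t)%MM => //; apply/te_MP; exists s, t.
move=> p; rewrite scale_one => p0 normal.
have : p \in ideal P.
  rewrite -[p]subr0; apply/quot_projE; rewrite p0.
  by rewrite -[LHS](scale0r one) scale_one.
(* In a monomial ideal each monomial of the support is a multiple of a generator, so normality
   leaves an empty support. *)
rewrite (hin.1 p) => p_in; apply/eqP; rewrite -msupp_eq0.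
case supp_p: (msupp p) => [//|c s0].
have cp : c \in msupp p by rewrite supp_p inE eqxx.
have [_ /te_MP[s [t [st ->]]] stc] := ideal_mons_support p_in cp.
by have := normal _ _ _ cp st; rewrite stc.
Qed.

End InitialIdeal.
End TwoEar.

Theorem theorem4p18 (K : fieldType) (m : nat) (hm : (1 <= m)%N)
  (G : sgraph) (phi : te_labeling m G)
  (le : rel 'X_{1..#|edge G|}) (hle : monomial_order le)
  (hin : minimal_mon_gens (initial_ideal le (toric_ideal K G)) (te_M phi))
  (i : nat) (hi : (i <= m)%N) :
  betti (edge_ring K G) i
  = betti (quot_mod (leading_mons le (toric_ideal K G))) i.
Proof. by rewrite (betti_edge_ring hle hin) (betti_initial hin). Qed.
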